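(* Suppose that $M$ is a $2n$-dimensional toric symplectic manifold with moment polytope $P\subset\mathbb{R}^n$ and action-angle coordinates $\alpha$, and let $\beta\in(0,1)$. Let $\mathcal P^m(\vec p,\vec\theta,\cdot)$ be the $m$-step transition probability of the Markov chain Toric-Symplectic-MCMC$(\beta)$ and let $\nu$ be the (normalized) symplectic measure on $M$. Then there are constants $R<\infty$ and $\rho<1$ so that for any $(\vec p,\vec\theta)\in\operatorname{int}(P)\times T^n$ and every $m\ge1$, $$\bigl|\alpha_\star\mathcal P^m(\vec p,\vec\theta,\cdot)-\nu\bigr|_{\mathrm{TV}}<R\rho^m .$$ That is, for any choice of starting point, the pushforward by $\alpha$ of the probability measure generated by Toric-Symplectic-MCMC$(\beta)$ on $P\times T^n$ converges geometrically (in the number of steps) to the symplectic measure on $M$.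
   Context: A $2n$-dimensional toric symplectic manifold is a compact connected symplectic manifold $(M,\omega)$ with an effective Hamiltonian action of the torus $T^n=(\mathbb{R}/2\pi\mathbb{Z})^n$; $\mu:M\to\mathbb{R}^n$ is the moment map and $P=\mu(M)$ the moment polytope, a convex polytope with nonempty interior. The symplectic measure $\nu$ is the measure given by the volume form $\frac1{n!}\omega^n$, normalized to be a probability measure. Action-angle coordinates are a map $\alpha:\operatorname{int}(P)\times T^n\to M$, a bijection onto the full-measure subset $\mu^{-1}(\operatorname{int}P)$, with $\mu(\alpha(\vec p,\vec\theta))=\vec p$, which is measure-preserving: it pushes $\lambda\times\tau$ forward to $\nu$, where $\lambda$ is normalized Lebesgue measure on $P$ and $\tau$ is the uniform probability measure on $T^n$ (such $\alpha$ exists by the Duistermaat–Heckman theorem). The Markov chain Toric-Symplectic-MCMC$(\beta)$ on $\operatorname{int}(P)\times T^n$ moves from $(\vec p,\vec\theta)$ as follows. With probability $\beta$, it does a hit-and-run step on $P$: choose a uniformly random unit vector $\vec v\in S^{n-1}$, choose $t$ uniformly from the interval $\{t:\vec p+t\vec v\in P\}$, and replace $\vec p$ by $\vec p+t\vec v$, leaving $\vec\theta$ fixed. With probability $1-\beta$, it replaces $\vec\theta$ by a uniformly random point of $T^n$, leaving $\vec p$ fixed. (Starting in $\operatorname{int}(P)$ the chain almost surely stays there.) The total variation distance is $|\eta_1-\eta_2|_{\mathrm{TV}}=\sup_A|\eta_1(A)-\eta_2(A)|$ over measurable sets $A$. *)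

(* Defs.v *)
From HB Require Import structures.
From mathcomp Require Import all_boot all_order all_algebra.
From mathcomp Require Import perm generic_quotient ring_quotient.
From mathcomp Require Import all_classical all_reals all_analysis.

Set Implicit Arguments.
Unset Strict Implicit.
Unset Printing Implicit Defensive.

Import Order.TTheory GRing.Theory Num.Theory.
Import numFieldNormedType.Exports.

Local Open Scope classical_set_scope.
Local Open Scope ring_scope.

(** * Measures on R^n *)

Definition measure_mx_display : measure_display -> measure_display.
Proof. exact. Qed.

Section measurable_matrix.
Context {d} {T : measurableType d} (m n : nat).

Definition mx_cylinders : set (set 'M[T]_(m, n)) :=
  [set A | exists i j, exists2 B, measurable B &
    A = (fun v : 'M[T]_(m, n) => v i j) @^-1` B].

Let mx_set0 : <<s mx_cylinders >> set0.
Proof. exact: sigma_algebra0. Qed.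

Let mx_setC A : <<s mx_cylinders >> A -> <<s mx_cylinders >> (~` A).
Proof. exact: sigma_algebraC. Qed.

Let mx_bigcup (F : (set 'M[T]_(m, n))^nat) :
  (forall i, <<s mx_cylinders >> (F i)) ->
  <<s mx_cylinders >> (\bigcup_i (F i)).
Proof. exact: sigma_algebra_bigcup. Qed.

(* As for [n.-tuple T], the sigma-algebra on matrices (hence on R^n = 'rV[R]_n)
   is the product one, i.e., for R the Borel one. *)
HB.instance Definition _ := @isMeasurable.Build (measure_mx_display d)
  'M[T]_(m, n) <<s mx_cylinders >> mx_set0 mx_setC mx_bigcup.

End measurable_matrix.

Lemma measurable_mx_entry d (T : measurableType d) m n i j :
  measurable_fun [set: 'M[T]_(m, n)] (fun v : 'M[T]_(m, n) => v i j).
Proof.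
move=> _ Y mY; rewrite setTI; apply: sub_sigma_algebra.
by exists i, j, Y.
Qed.

Lemma measurable_fun_mx d d' (U : measurableType d') (T : measurableType d) m n
    (f : U -> 'M[T]_(m, n)) :
  (forall i j, measurable_fun [set: U] (fun x => f x i j)) ->
  measurable_fun [set: U] f.
Proof.
move=> mf; apply: (@measurability _ _ _ _ _ _ (@mx_cylinders _ T m n)) => //.
move=> _ [_ [i [j [B mB ->]]] <-].
by rewrite setTI; have := mf i j measurableT B mB; rewrite setTI.
Qed.

Definition rV_cons {R : realType} {n} (p : R * 'rV[R]_n) : 'rV[R]_n.+1 :=
  row_mx p.1%:M p.2.

Fixpoint lebesgue_rV {R : realType} n : set 'rV[R]_n -> \bar R :=
  if n is k.+1
  then pushforward (lebesgue_measure \x @lebesgue_rV R k)%E rV_cons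
  else \d_(0 : 'rV[R]_0).
Arguments lebesgue_rV {R} n A.

Section lebesgue_rV_measure.
Context {R : realType}.

Lemma measurable_rV_cons n : measurable_fun setT (@rV_cons R n).
Proof.
apply: measurable_fun_mx => i j; rewrite /rV_cons (ord1 i).
have [k ->|k ->] := split_ordP (j : 'I_(1 + n)).
  rewrite (_ : (fun x => _) = fst); first exact: measurable_fst.
  apply/funext => x; apply: (etrans (@row_mxEl _ 1 1 n _ _ 0 k)).
  by rewrite (ord1 k) mxE eqxx mulr1n.
rewrite (_ : (fun x => _) = (fun v : 'rV[R]_n => v 0 k) \o snd); last first.
  by apply/funext => x; exact: (@row_mxEr _ 1 1 n _ _ 0 k).
by apply: measurableT_comp; [exact: measurable_mx_entry|exact: measurable_snd].
Qed.

Let uncons n (v : 'rV[R]_n.+1) : R * 'rV[R]_n :=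
  (v 0 0, rsubmx (v : 'rV_(1 + n))).

Let measurable_uncons n : measurable_fun setT (@uncons n).
Proof.
apply/measurable_fun_pairP; split; first exact: measurable_mx_entry.
apply: measurable_fun_mx => i j.
by under eq_fun do rewrite /= mxE; exact: measurable_mx_entry.
Qed.

Let consK n : cancel (@rV_cons R n) (@uncons n).
Proof.
move=> [t v]; rewrite /uncons /rV_cons row_mxKr; congr pair.
have -> : 0 = lshift n (0 : 'I_1) by apply/val_inj.
by apply: (etrans (@row_mxEl _ 1 1 n _ _ 0 0)); rewrite mxE eqxx mulr1n.
Qed.

Let prod_sigma_finite d1 d2 (T1 : measurableType d1) (T2 : measurableType d2)
    (m1 : {sigma_finite_measure set T1 -> \bar R})
    (m2 : {sigma_finite_measure set T2 -> \bar R}) :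
  sigma_finite setT (m1 \x m2)%E.
Proof.
have /sigma_finiteP[F [TF ndF Foo]] := sigma_finiteT m1.
have /sigma_finiteP[G [TG ndG Goo]] := sigma_finiteT m2.
exists (fun n => F n `*` G n).
  rewrite -setXTT TF TG predeqE => -[x y]; split.
    move=> [/= [n _ Fnx] [k _ Gky]]; exists (maxn n k) => //; split.
    - by move: x Fnx; exact/subsetPset/ndF/leq_maxl.
    - by move: y Gky; exact/subsetPset/ndG/leq_maxr.
  by move=> [n _ []/= ? ?]; split; exists n.
move=> k; have [? ?] := Foo k; have [? ?] := Goo k.
split; first exact: measurableX.
by rewrite product_measure1E// lte_mul_pinfty// ge0_fin_numE.
Qed.

Let lebesgue_rV_ex n :
  exists k : {sigma_finite_measure set 'rV[R]_n -> \bar R},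
    lebesgue_rV n = k :> (set _ -> _).
Proof.
elim: n => [|n [k kE]]; first by exists (\d_(0 : 'rV[R]_0)).
pose p := pushforward (@lebesgue_measure R \x k)%E (@rV_cons R n).
have mC : measurable_fun setT (@rV_cons R n) := @measurable_rV_cons n.
have p0 : p set0 = 0%E by rewrite /p /pushforward preimage_set0 measure0.
have pge A : (0 <= p A)%E by exact: measure_ge0.
have ps : semi_sigma_additive p.
  move=> F mF tF mU; rewrite /p /pushforward preimage_bigcup.
  apply: measure_semi_sigma_additive.
  - by move=> i; rewrite -[X in measurable X]setTI; exact: mC.
  - apply/trivIsetP => i j _ _ ij; rewrite -preimage_setI.
    by move/trivIsetP : tF => /(_ _ _ I I ij) ->; rewrite preimage_set0.
  - by rewrite -preimage_bigcup -[X in measurable X]setTI; exact: mC.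
have sf : sigma_finite setT p.
  have [F TF Foo] : sigma_finite setT (@lebesgue_measure R \x k)%E.
    exact: prod_sigma_finite.
  exists (fun i => @uncons n @^-1` F i).
    by rewrite -preimage_bigcup -TF preimage_setT.
  move=> i; have [mF Fi] := Foo i; split.
    by rewrite -[X in measurable X]setTI; exact: measurable_uncons.
  rewrite /p /pushforward -comp_preimage (_ : _ \o _ = id) //.
  by apply/funext => x; exact: consK.
have pE : p = pushforward (@lebesgue_measure R \x k)%E rV_cons by [].
rewrite /= kE -pE; clearbody p.
pose H1 := isMeasure.Build _ _ _ p p0 pge ps.
pose pm : {measure set 'rV[R]_n.+1 -> \bar R} := HB.pack p H1.
pose H2 := Measure_isSigmaFinite.Build _ _ _ pm sf.
pose pf : {sigma_finite_measure set 'rV[R]_n.+1 -> \bar R} := HB.pack p H1 H2.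
by exists pf.
Qed.

Let leb0 n : lebesgue_rV n (set0 : set 'rV[R]_n) = 0%E.
Proof. by have [k ->] := lebesgue_rV_ex n; exact: measure0. Qed.

Let leb_ge0 n (A : set 'rV[R]_n) : (0 <= lebesgue_rV n A)%E.
Proof. by have [k ->] := lebesgue_rV_ex n; exact: measure_ge0. Qed.

Let leb_sigma_additive n :
  semi_sigma_additive (lebesgue_rV n : set 'rV[R]_n -> _).
Proof.
by have [k ->] := lebesgue_rV_ex n; exact: measure_semi_sigma_additive.
Qed.

HB.instance Definition _ n := isMeasure.Build _ _ _
  (lebesgue_rV n : set 'rV[R]_n -> _)
  (@leb0 n) (@leb_ge0 n) (@leb_sigma_additive n).

Let leb_sigma_finite n : sigma_finite setT (lebesgue_rV n : set 'rV[R]_n -> _).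
Proof. by have [k ->] := lebesgue_rV_ex n; exact: sigma_finiteT. Qed.

HB.instance Definition _ n := Measure_isSigmaFinite.Build _ _ _
  (lebesgue_rV n : set 'rV[R]_n -> _) (@leb_sigma_finite n).

End lebesgue_rV_measure.

Section euclidean_measures.
Context {R : realType}.

(* The law of a [mu]-uniform point of [D]; meaningful for 0 < mu D < +oo. *)
Definition uniform_on {d} {T : measurableType d} (mu : set T -> \bar R)
    (D A : set T) : \bar R := (mu (A `&` D) / mu D)%E.

(* [`|v|] is the sup norm on 'rV[R]_n, so the Euclidean norm is explicit. *)
Definition norm2 n (v : 'rV[R]_n) : R := Num.sqrt (\sum_i v 0 i ^+ 2).

(* Uniform probability on the unit sphere: the direction of a uniform point of
   the unit ball. *)
Definition sphere_uniform n : set 'rV[R]_n -> \bar R :=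
  pushforward (uniform_on (lebesgue_rV n) [set u | norm2 u <= 1])
    (fun u => (norm2 u)^-1 *: u).

Definition tv_dist {d} {T : measurableType d} (mu1 mu2 : set T -> \bar R) :
    \bar R :=
  ereal_sup [set `|mu1 A - mu2 A|%E | A in measurable].

End euclidean_measures.
Arguments sphere_uniform {R} n A.

(** * The torus T^n = (R / 2 pi Z)^n *)

Definition two_pi_int {R : realType} : {pred R} :=
  fun x => x / (2 * pi) \is a Num.int.

Lemma two_pi_int_zmod_closed {R : realType} : zmod_closed (@two_pi_int R).
Proof.
split=> [|x y]; first by rewrite unfold_in /two_pi_int mul0r rpred0.
rewrite unfold_in => hx; rewrite unfold_in => hy.
by rewrite unfold_in /two_pi_int mulrBl rpredB.
Qed.

HB.instance Definition _ (R : realType) :=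
  GRing.isZmodClosed.Build R (@two_pi_int R) two_pi_int_zmod_closed.

Definition circle (R : realType) := Quotient.quot (@two_pi_int R).

HB.instance Definition _ (R : realType) := GRing.Zmodule.on (circle R).
HB.instance Definition _ (R : realType) :=
  isPointed.Build (circle R) (0 : circle R).

Definition circle_proj {R : realType} (x : R) : circle R :=
  (\pi_(Quotient.quot (@two_pi_int R)) x)%qT.

Definition circle_display : measure_display. Proof. exact. Qed.

Section measurable_circle.
Context {R : realType}.

Let msr (A : set (circle R)) := measurable (circle_proj @^-1` A).

Let msr0 : msr set0. Proof. by rewrite /msr preimage_set0. Qed.

Let msrC A : msr A -> msr (~` A).
Proof. by rewrite /msr -preimage_setC; exact: measurableC. Qed.

Let msr_bigcup (F : (set (circle R))^nat) :
  (forall i, msr (F i)) -> msr (\bigcup_i F i).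
Proof.
by move=> mF; rewrite /msr preimage_bigcup; exact: bigcupT_measurable.
Qed.

(* The quotient sigma-algebra, which is the Borel one. *)
HB.instance Definition _ := @isMeasurable.Build circle_display
  (circle R) msr msr0 msrC msr_bigcup.

End measurable_circle.

Notation torus R n := 'rV[circle R]_n.

Definition torus_proj {R : realType} {n} (s : 'rV[R]_n) : torus R n :=
  map_mx circle_proj s.

Definition torus_uniform {R : realType} {n} : set (torus R n) -> \bar R :=
  pushforward
    (uniform_on (lebesgue_rV n) [set s | forall i, 0 <= s 0 i < 2 * pi])
    torus_proj.

(** * Toric-Symplectic-MCMC *)

Definition convex_polytope {R : realType} {n} (P : set 'rV[R]_n) : Prop :=
  exists N (v : 'I_N -> 'rV[R]_n),
    P = [set x | exists w : 'I_N -> R,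
      [/\ forall i, 0 <= w i, \sum_i w i = 1 & x = \sum_i w i *: v i]].

Section toric_symplectic_mcmc.
Context {R : realType} {n : nat} (P : set 'rV[R]_n) (beta : R).

Definition hit_and_run (p : 'rV[R]_n) : set 'rV[R]_n -> \bar R :=
  fun A => (\int[sphere_uniform n]_v
    pushforward (uniform_on lebesgue_measure [set t : R | P (p + t *: v)%R])
      (fun t : R => p + t *: v)%R A)%E.

(* The kernels act on R^n * T^n; started in P° * T^n, the chain almost surely
   never leaves it. *)
Definition tsmcmc_step (x : 'rV[R]_n * torus R n) :
    set ('rV[R]_n * torus R n) -> \bar R :=
  fun A => (beta%:E * hit_and_run x.1 [set p | A (p, x.2)]
    + (1 - beta)%:E * torus_uniform [set theta | A (x.1, theta)])%E.

Fixpoint tsmcmc (m : nat) (x : 'rV[R]_n * torus R n) :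
    set ('rV[R]_n * torus R n) -> \bar R :=
  if m is k.+1 then fun A => (\int[tsmcmc_step x]_y tsmcmc k y A)%E
  else \d_x.

End toric_symplectic_mcmc.

(** * Toric symplectic manifolds *)

Section smooth.
Context {R : realType} {m : nat}.

Fixpoint Ck (k : nat) {W : normedModType R} (U : set 'rV[R]_m)
    (f : 'rV[R]_m -> W) : Prop :=
  (forall x, U x -> {for x, continuous f}) /\
  if k is l.+1 then
    forall i : 'I_m, (forall x, U x -> derivable f x (delta_mx 0 i)) /\
      Ck l U (fun x => 'D_(delta_mx 0 i) f x)
  else True.

(* For [U] open. *)
Definition smooth_on {W : normedModType R} (U : set 'rV[R]_m)
  (f : 'rV[R]_m -> W) : Prop := forall k, Ck k U f.

End smooth.

(* A smooth manifold is a Hausdorff space with a smooth atlas; second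
   countability is automatic for a compact one. *)
Record compact_manifold (R : realType) (m : nat) := CompactManifold {
  point_of :> ptopologicalType ;
  chart : Type ;
  cdom : chart -> set point_of ;
  cmap : chart -> point_of -> 'rV[R]_m ;
  cinv : chart -> 'rV[R]_m -> point_of ;
  mfd_hausdorff : hausdorff_space point_of ;
  mfd_compact : compact [set: point_of] ;
  mfd_connected : connected [set: point_of] ;
  cdom_cover : forall x, exists i, cdom i x ;
  cdom_open : forall i, open (cdom i) ;
  cimg_open : forall i, open (cmap i @` cdom i) ;
  cmapK : forall i x, cdom i x -> cinv i (cmap i x) = x ;
  cmap_continuous : forall i x, cdom i x -> {for x, continuous (cmap i)} ;
  cinv_continuous : forall i y, (cmap i @` cdom i) y ->
    {for y, continuous (cinv i)} ;
  transition_smooth : forall i j,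
    smooth_on (cmap i @` (cdom i `&` cdom j)) (cmap j \o cinv i) }.

Definition cimg {R : realType} {m} (M : compact_manifold R m) (i : chart M) :
  set 'rV[R]_m := cmap i @` cdom i.

(* [sform i y a b] is omega(d_a, d_b) at the point of coordinates [y] in the
   chart [i]. *)
Record symplectic_form (R : realType) (m : nat) (M : compact_manifold R m) :=
  SymplecticForm {
  sform :> chart M -> 'rV[R]_m -> 'M[R]_m ;
  sform_smooth : forall i, smooth_on (cimg i) (sform i) ;
  sform_antisym : forall i y, cimg i y -> (sform i y)^T = - sform i y ;
  sform_nondegenerate : forall i y, cimg i y -> sform i y \in unitmx ;
  sform_closed : forall i y a b c, cimg i y ->
    'D_(delta_mx 0 a) (fun z => sform i z b c) y
    + 'D_(delta_mx 0 b) (fun z => sform i z c a) y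
    + 'D_(delta_mx 0 c) (fun z => sform i z a b) y = 0 ;
  (* [jacobian f y] acts on row vectors: 'D_v f y = v *m jacobian f y *)
  sform_compat : forall i j y, (cmap i @` (cdom i `&` cdom j)) y ->
    let f := cmap j \o cinv i in
    sform i y = jacobian f y *m sform j (f y) *m (jacobian f y)^T }.

(* Hamiltonian effective action of T^n with moment map [moment]; smoothness is
   that of the lift to R^n * M of the action. *)
Record hamiltonian_action (R : realType) (m n : nat) (M : compact_manifold R m)
    (omega : symplectic_form M) := HamiltonianAction {
  tact : torus R n -> M -> M ;
  moment : M -> 'rV[R]_n ;
  tact0 : forall x, tact 0 x = x ;
  tactD : forall s t x, tact (s + t) x = tact s (tact t x) ;
  tact_continuous :
    continuous (fun z : 'rV[R]_n * M => tact (torus_proj z.1) z.2) ;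
  tact_smooth : forall i j,
    let f (z : 'rV[R]_(n + m)) :=
      tact (torus_proj (lsubmx z)) (cinv i (rsubmx z)) in
    smooth_on [set z | cimg i (rsubmx z) /\ cdom j (f z)] (cmap j \o f) ;
  tact_effective : forall s, (forall x, tact s x = x) -> s = 0 ;
  moment_smooth : forall i, smooth_on (cimg i) (moment \o cinv i) ;
  moment_invariant : forall s x, moment (tact s x) = moment x ;
  (* d mu_k = omega(X_k, .), with X_k the generator of the k-th circle *)
  moment_hamiltonian : forall i y (k : 'I_n) v, cimg i y ->
    let X := derive1 (fun t : R =>
      cmap i (tact (torus_proj (t *: delta_mx 0 k)) (cinv i y))) 0 in
    'D_v (fun z => moment (cinv i z) 0 k) y = (X *m omega i y *m v^T) 0 0 }.

Record toric_manifold (R : realType) (n : nat) := ToricManifold {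
  tmfd :> compact_manifold R n.*2 ;
  tform : symplectic_form tmfd ;
  taction : hamiltonian_action n tform }.

Definition moment_map {R : realType} {n} (M : toric_manifold R n) :
  M -> 'rV[R]_n := moment (taction M).
Arguments moment_map {R n} M x.

Definition moment_polytope {R : realType} {n} (M : toric_manifold R n)
    (P : set 'rV[R]_n) : Prop :=
  [/\ P = range (moment_map M), convex_polytope P & P° !=set0].

Definition ord_even {n} (i : 'I_n) : 'I_n.*2 :=
  Ordinal (etrans (ltn_double i n) (ltn_ord i)).

Definition ord_odd {n} (i : 'I_n) : 'I_n.*2 :=
  Ordinal (etrans (ltn_Sdouble i n) (ltn_ord i)).

(* The coefficient of omega^n / n! on dx_1 /\ ... /\ dx_2n (the Pfaffian),
   for omega of matrix [A]. *)
Definition pfaffian {R : realType} {n} (A : 'M[R]_n.*2) : R :=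
  (2 ^+ n * n`!%:R)^-1 * \sum_(s : 'S_(n.*2))
    (-1) ^+ s * \prod_(i < n) A (s (ord_even i)) (s (ord_odd i)).

Definition borel (M : ptopologicalType) := g_sigma_algebraType (@open M).

(* [L] is the Borel measure given by the volume form omega^n / n!, which is
   positive for the orientation it defines, whence the absolute value. *)
Definition volume_measure {R : realType} {n} (M : toric_manifold R n)
    (L : {measure set (borel M) -> \bar R}) : Prop :=
  forall i (A : set (borel M)), measurable A -> A `<=` cdom i ->
    L A = (\int[lebesgue_rV n.*2]_(y in cmap i @` A)
             `|pfaffian (tform M i y)|%:E)%E.

Definition symplectic_measure {R : realType} {n} (M : toric_manifold R n)
    (nu : probability (borel M) R) : Prop :=
  exists L : {measure set (borel M) -> \bar R}, volume_measure L /\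
    forall A, measurable A -> nu A = (L A / L setT)%E.

Section action_angle.
Context {R : realType} {n : nat} (M : toric_manifold R n).
Context (nu : probability (borel M) R) (P : set 'rV[R]_n).
Context (alpha : 'rV[R]_n * torus R n -> borel M).

(* [alpha] is only meaningful on int(P) * T^n. *)
Definition aa_dom : set ('rV[R]_n * torus R n) := P° `*` setT.

Definition aa_pushforward (eta : set ('rV[R]_n * torus R n) -> \bar R) :
    set (borel M) -> \bar R :=
  fun B => eta (aa_dom `&` alpha @^-1` B).

Definition action_angle : Prop :=
  [/\ set_bij aa_dom (moment_map M @^-1` P°) alpha,
      nu (moment_map M @^-1` P°) = 1%E,
      forall p theta, P° p -> moment_map M (alpha (p, theta)) = p,
      measurable_fun aa_dom alpha &
      forall B, measurable B ->
        aa_pushforward (uniform_on (lebesgue_rV n) P \x torus_uniform)%E B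
        = nu B].

End action_angle.

(* Main.v *)
Require Import Defs.
From HB Require Import structures.
From mathcomp Require Import all_boot all_order all_algebra.
From mathcomp Require Import all_classical all_reals all_analysis.
From mathcomp Require Import measurable_realfun ring lra.
Import Order.TTheory GRing.Theory Num.Theory.
Import numFieldNormedType.Exports.
Local Open Scope classical_set_scope.
Local Open Scope ring_scope.

(** The hypothesis on [alpha] says that [nu] is the law of [alpha (p, theta)] for
    [p] uniform on [P] and [theta] uniform on the torus, independent. So the total
    variation distance on the manifold is at most the distance, on int(P) * T^n,
    between the law of the chain after [m] steps and the product [pi] of the two
    uniform laws, and what is proved is the uniform ergodicity of the chain there.
    Taking the whole manifold as test set, the same hypothesis gives that P has
    finite positive volume, that its boundary is null, and that the uniform law of
    the torus has mass one. P is compact as the image of the manifold under the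
    moment map, and convex as a polytope.

    Uniform ergodicity is Doeblin's argument. Suppose that [pi] is invariant
    under a kernel [Q] and that from every point of int(P) * T^n the law of two
    steps of [Q] dominates [eps * pi]. If a function [f] is at least [c] on that
    set, then two steps improve the bound to [c + eps (pi f - c)], because [f - c]
    is nonnegative and its mean is [pi f - c] by invariance. Applied to the
    [m]-step probability of a set A, whose mean is always [pi A], this gives
    [Q^m x A >= (1 - (1 - eps)^(m/2)) pi A]; the complement of A gives the upper
    bound ([doeblin_geometric]). Two steps are needed since one step moves either
    the point or the angle, never both.

    For the chain at hand, two steps dominate a hit-and-run step followed by a
    refreshment of the angle, so the minorization reduces to: hit-and-run from
    an interior point [p] dominates a multiple of Lebesgue measure on P, uniform
    in [p] ([hit_and_run_minorization]). Chords of P have length at most [2 M],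
    with [M] a bound for the diameter, so the step dominates [(2 M)^-1] times
    the mean over directions [v] of the length of the part of the line [p + t v]
    in a given set. In polar coordinates around [p] that mean is a multiple of
    the integral of [norm2 (q - p)] to the power [1 - n], which is bounded below
    since the distance is at most [M]. As a direction is by definition that of a
    uniform point of the unit ball, a lower bound of this kind needs no surface
    measure: it follows from Fubini's theorem and the affine change of variable
    [q = p + s u] in Lebesgue measure ([sphere_rays_lower]).

    Invariance of the uniform law on P under hit-and-run holds direction by
    direction: translation along [v] preserves both Lebesgue measure and the
    chord through a point, and integrating out the displacement gives back the
    chord length ([line_average_invariant]). Finally the chain stays in the
    interior, since by convexity a line through an interior point meets the
    boundary of P in at most two points ([line_boundary_null]). *)

Set Implicit Arguments.
Unset Strict Implicit.
Unset Printing Implicit Defensive.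

(** * Borel sets and Lebesgue measure on row spaces *)

Section row_space.
Context {R : realType}.

(** The sigma-algebra is the product one, so openness is used through a countable
    base: cubes with rational centre and radius [1 / (k + 1)]. *)
Lemma open_measurable_rV n (U : set 'rV[R]_n) : open U -> measurable U.
Proof.
move=> oU.
pose box (z : 'rV[rat]_n * nat) : set 'rV[R]_n :=
  [set y | forall j, `|ratr (z.1 0 j) - y 0 j| < z.2.+1%:R^-1].
have mbox z : measurable (box z).
  rewrite (_ : box z = \bigcap_(j in [set: 'I_n])
     ((fun y : 'rV[R]_n => y 0 j) @^-1`
        ball (ratr (z.1 0 j) : R) z.2.+1%:R^-1)); last first.
    apply/seteqP; split=> y /=; first by move=> zy j _; exact: zy.
    by move=> zy j; exact: (zy j I).
  apply: fin_bigcap_measurable => [|j _]; first exact: finite_finset.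
  rewrite -[X in measurable X]setTI; apply: measurable_mx_entry => //.
  exact: measurable_ball.
have -> : U = \bigcup_z (if `[< box z `<=` U >] then box z else set0).
  apply/seteqP; split=> [x Ux|x [z _]]; last by case: asboolP => // + ?; apply.
  have /nbhs_ballP[e /= e0 xeU] := open_nbhs_nbhs (conj oU Ux).
  have [k ke] : exists k : nat, k.+1%:R^-1 < e / 2.
    have [k] := @ltr_add_invr _ 0 (e / 2) (divr_gt0 e0 (ltr0Sn _ 1)).
    by rewrite add0r => ?; exists k.
  (* a rational point strictly above [x 0 j], closer than the radius *)
  have q j : {q : rat | ratr q \in `]x 0 j, (x 0 j + k.+1%:R^-1)[}.
    apply/cid/rat_in_itvoo; rewrite ltrDl invr_gt0 ltr0n//.
  exists (\row_j sval (q j), k) => //; case: asboolP => [_ j /=|].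
    rewrite mxE; case: (q j) => r /=; rewrite in_itv/= => /andP[xr rx].
    by rewrite ger0_norm ?subr_ge0 ?ltW// ltrBlDl.
  case=> y /= ky; apply: xeU; split=> // i j; rewrite (ord1 i) /ball/=.
  have := ky j; rewrite mxE; case: (q j) => r /=; rewrite in_itv/= => /andP[].
  move: (x 0 j) (y 0 j) (ratr r : R) ke => a b c.
  move: (k.+1%:R^-1) => s se ac ca cb.
  rewrite ltr_norml; move: cb; rewrite ltr_norml => /andP[? ?].
  apply/andP; split; lra.
apply: countable_bigcupT_measurable => [|z]; first exact: countableP.
by case: ifP.
Qed.

Lemma measurable_norm2 n : measurable_fun setT (@norm2 R n).
Proof.
rewrite (_ : @norm2 R n = (fun x => Num.sqrt x) \o
  (fun v : 'rV[R]_n => \sum_(i < n) v 0 i ^+ 2)) //.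
apply: measurableT_comp.
  apply: continuous_measurable_fun; exact: sqrt_continuous.
apply: measurable_sum => i; apply: measurable_funX; exact: measurable_mx_entry.
Qed.

Lemma measurable_rV_add d (T : measurableType d) n (f g : T -> 'rV[R]_n) :
  measurable_fun setT f -> measurable_fun setT g ->
  measurable_fun setT (fun x => f x + g x).
Proof.
move=> mf mg; apply: measurable_fun_mx => i j.
under eq_fun do rewrite mxE.
by apply: measurable_funD; apply: (measurableT_comp (measurable_mx_entry i j)).
Qed.

Lemma measurable_rV_opp d (T : measurableType d) n (f : T -> 'rV[R]_n) :
  measurable_fun setT f -> measurable_fun setT (fun x => - f x).
Proof.
move=> mf; apply: measurable_fun_mx => i j.
under eq_fun do rewrite mxE.
by apply: measurable_funN; apply: (measurableT_comp (measurable_mx_entry i j)).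
Qed.

Lemma measurable_rV_scale d (T : measurableType d) n (f : T -> R)
    (g : T -> 'rV[R]_n) :
  measurable_fun setT f -> measurable_fun setT g ->
  measurable_fun setT (fun x => f x *: g x).
Proof.
move=> mf mg; apply: measurable_fun_mx => i j.
under eq_fun do rewrite mxE.
apply: measurable_funM => //; exact: (measurableT_comp (measurable_mx_entry i j)).
Qed.

(** The image of a measure as a measure, so that the measurability of the map is
    found in the term and not left to unification. *)
Definition pushforward_law d1 d2 (T1 : measurableType d1) (T2 : measurableType d2)
  (mu : {measure set T1 -> \bar R}) (f : T1 -> T2) (mf : measurable_fun setT f) :
  {measure set T2 -> \bar R} :=
  @measure_function_pushforward__canonical__measure_function_Measure _ _ _ _ _ mu _ mf.

(** Both sides are measures of [A] up to the factor, so it is enough to compare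
    them on half-open intervals. *)
Lemma lebesgue_measure_affine (a b : R) (A : set R) : a != 0 -> measurable A ->
  lebesgue_measure ((fun x => a * x + b) @^-1` A) =
  (`|a|^-1%:E * lebesgue_measure A)%E.
Proof.
move=> a0 mA; have na0 : 0 < `|a| by rewrite normr_gt0.
pose phi : R -> measurableTypeR R := fun x => a * x + b.
have mphi : measurable_fun setT phi.
  by apply: measurable_funD => //; exact: mulrl_measurable.
pose mu := mscale (NngNum (ltW na0)) (pushforward_law (@lebesgue_measure R) mphi).
suff -> : lebesgue_measure A = mu A.
  by rewrite /mu /mscale/= muleA -EFinM mulVf ?gt_eqF// mul1e.
apply: lebesgue_measure_unique => // _ [[p q]] _ <-.
rewrite /mu /mscale/= /pushforward.
have [pq|pq] := ltP p q; last first.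
  by rewrite !set_itv_ge ?preimage_set0 ?measure0 ?mule0// bnd_simp -leNgt.
transitivity (`|a|%:E * lebesgue_measure (phi @^-1` `]p, q] : set R))%E; last by [].
rewrite lebesgue_measure_itv/= lte_fin pq.
move: a0; rewrite neq_lt => /orP[a0|a0].
- have -> : phi @^-1` `]p, q] = `[(q - b) / a, (p - b) / a[%classic.
    apply/funext => x; rewrite /preimage/= !in_itv/= ler_ndivrMr// ltr_ndivlMr//.
    by rewrite /phi; apply/propext; split=> /andP[? ?]; apply/andP; split; lra.
  rewrite lebesgue_measure_itv/= lte_fin ltr_ndivrMr// divfK ?lt_eqF//.
  rewrite ltrBlDr subrK pq -!EFinB -EFinM ltr0_norm//; congr EFin.
  by field; rewrite lt_eqF.
- have -> : phi @^-1` `]p, q] = `](p - b) / a, (q - b) / a]%classic.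
    apply/funext => x; rewrite /preimage/= !in_itv/= ltr_pdivrMr// ler_pdivlMr//.
    by rewrite /phi; apply/propext; split=> /andP[? ?]; apply/andP; split; lra.
  rewrite lebesgue_measure_itv/= lte_fin ltr_pdivrMr// divfK ?gt_eqF//.
  rewrite ltrBlDr subrK pq -!EFinB -EFinM gtr0_norm//; congr EFin.
  by field; rewrite gt_eqF.
Qed.

Lemma ge0_integral_affine (a b : R) (f : R -> \bar R) : a != 0 ->
  measurable_fun setT f -> (forall x, 0 <= f x)%E ->
  (\int[lebesgue_measure]_x f (a * x + b)%R =
   `|a|^-1%:E * \int[lebesgue_measure]_x f x)%E.
Proof.
move=> a0 mf f0.
pose phi : R -> measurableTypeR R := fun x => a * x + b.
have mphi : measurable_fun setT phi.
  by apply: measurable_funD => //; exact: mulrl_measurable.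
have na0 : 0 <= `|a|^-1 by rewrite invr_ge0.
transitivity (\int[pushforward lebesgue_measure phi]_x f x)%E.
  by rewrite ge0_integral_pushforward// preimage_setT.
rewrite -(@ge0_integral_mscale _ _ _ _ _ _ (NngNum na0))//.
apply: (@eq_measure_integral _ _ _ _ (mscale (NngNum na0) lebesgue_measure)
  (pushforward_law lebesgue_measure mphi)) => A mA _.
exact: lebesgue_measure_affine.
Qed.

Lemma rV_cons_affine n (s : R) (p : 'rV[R]_n.+1) (z : R * 'rV[R]_n) :
  p + s *: rV_cons z =
  rV_cons (s * z.1 + p 0 0, rsubmx (p : 'rV_(1 + n)) + s *: z.2).
Proof.
apply/rowP => j; rewrite /rV_cons !mxE.
have [k jk|k jk] := split_ordP (j : 'I_(1 + n)); rewrite ?mxE.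
  by rewrite (ord1 k) eqxx !mulr1n addrC; congr (_ + p 0 _);
    rewrite jk (ord1 k); exact/val_inj.
by rewrite jk.
Qed.

(** Induction on the dimension: the sections of the preimage are preimages of
    sections by an affine map of the same ratio, and the first coordinate
    contributes one more factor [s^-1]. *)
Lemma lebesgue_rV_affine n (s : R) (p : 'rV[R]_n) (A : set 'rV[R]_n) : 0 < s ->
  measurable A ->
  lebesgue_rV n ((fun u => p + s *: u) @^-1` A) =
  ((s ^- n)%:E * lebesgue_rV n A)%E.
Proof.
move=> s0; elim: n p A => [|n IHn] p A mA.
  rewrite expr0 invr1 mul1e /=; congr (\d_ _ _).
  by apply/funext => u; congr A; rewrite thinmx0; exact/esym/thinmx0.
have mA' : measurable (rV_cons @^-1` A).
  by rewrite -[X in measurable X]setTI; exact: measurable_rV_cons.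
rewrite /= /pushforward /product_measure1.
set phi := (lebesgue_rV n \o xsection (rV_cons @^-1` A)).
transitivity (\int[lebesgue_measure]_x ((s ^- n)%:E * phi (s * x + p 0 0)%R))%E.
  apply: eq_integral => x _; rewrite /phi /comp.
  rewrite -(IHn (rsubmx (p : 'rV_(1 + n)))); last exact: measurable_xsection.
  congr (lebesgue_rV n _); apply/seteqP; split => w;
  by rewrite /xsection/= !inE/= rV_cons_affine.
have mphi : measurable_fun setT phi by exact: measurable_fun_xsection.
rewrite ge0_integralZl//; last 2 first.
  - apply: (measurableT_comp mphi).
    by apply: measurable_funD => //; exact: mulrl_measurable.
  by rewrite lee_fin invr_ge0 exprn_ge0// ltW.
rewrite ge0_integral_affine ?gt_eqF// muleA -EFinM; congr (_%:E * _)%E.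
by rewrite gtr0_norm// exprSr invfM.
Qed.

Lemma ge0_integral_rV_affine n (s : R) (p : 'rV[R]_n) (f : 'rV[R]_n -> \bar R) :
  0 < s -> measurable_fun setT f -> (forall x, 0 <= f x)%E ->
  (\int[lebesgue_rV n]_u f (p + s *: u)%R =
   (s ^- n)%:E * \int[lebesgue_rV n]_q f q)%E.
Proof.
move=> s0 mf f0.
pose phi u : 'rV[R]_n := p + s *: u.
have mphi : measurable_fun setT phi.
  by apply: measurable_rV_add => //; exact: measurable_rV_scale.
have sn0 : 0 <= s ^- n by rewrite invr_ge0 exprn_ge0// ltW.
transitivity (\int[pushforward (lebesgue_rV n) phi]_x f x)%E.
  by rewrite ge0_integral_pushforward// preimage_setT.
rewrite -(@ge0_integral_mscale _ _ _ _ _ _ (NngNum sn0))//.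
apply: (@eq_measure_integral _ _ _ _ (mscale (NngNum sn0) (lebesgue_rV n))
  (pushforward_law (lebesgue_rV n) mphi)) => A mA _.
exact: lebesgue_rV_affine.
Qed.

End row_space.

(** * Uniform laws *)

Lemma ge0_integral_concentrated d (T : measurableType d) (R : realType)
    (mu : {measure set T -> \bar R}) (D : set T) (f : T -> \bar R) :
  measurable D -> mu (~` D) = 0%E ->
  measurable_fun setT f -> (forall x, 0 <= f x)%E ->
  (\int[mu]_x f x = \int[mu]_(x in D) f x)%E.
Proof.
move=> mD D0 mf f0.
rewrite (ge0_negligible_integral (measurableC mD) measurableT mf _ D0)//.
by rewrite setTD setCK.
Qed.

Section uniform_law.
Context {R : realType} {d} {T : measurableType d}.
Variables (mu : {measure set T -> \bar R}) (D : set T).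
Local Open Scope ereal_scope.

Lemma uniform_on_ge0 A : 0 <= uniform_on mu D A.
Proof. by rewrite /uniform_on mule_ge0// inve_ge0. Qed.

(** With the real inverse, which is zero at zero, this also covers the degenerate
    cases [mu D = 0] and [mu D = +oo], in which the uniform law is zero. *)
Lemma uniform_onE (mD : measurable D) A : measurable A ->
  uniform_on mu D A = ((fine (mu D))^-1)%:E * mu (A `&` D).
Proof.
move=> mA; rewrite /uniform_on muleC.
have : mu (A `&` D) <= mu D by exact: measureIr.
have : 0 <= mu D by [].
case: (mu D) => [r| |] //= r0.
  rewrite /inve; case: eqP => [->|//]; rewrite invr0 mul0e.
  move=> ADle; rewrite (_ : mu (A `&` D) = 0) ?mule0//.
  by apply/eqP; rewrite eq_le ADle/=.
by rewrite /inve invr0 !mul0e.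
Qed.

Lemma uniform_on_le1 A : measurable D -> measurable A -> uniform_on mu D A <= 1.
Proof.
move=> mD mA; rewrite uniform_onE//.
have : mu (A `&` D) <= mu D by exact: measureIr.
have : 0 <= mu D by [].
case: (mu D) => [r| |] //= r0 ADr; last by rewrite invr0 mul0e lee01.
apply: (@le_trans _ _ (r^-1%:E * r%:E)).
  by rewrite lee_wpmul2l// lee_fin invr_ge0.
have [->|r1] := eqVneq r 0%R; first by rewrite mule0 lee01.
by rewrite -EFinM mulVf.
Qed.

Hypothesis mD : measurable D.

(** [uniform_on] with the measurability of the set as a phantom argument, which
    makes the measure structure inferable. *)
Definition uniform_law of measurable D : set T -> \bar R := uniform_on mu D.
Local Notation unif := (uniform_law mD).

Let k0 : (0 <= (fine (mu D))^-1)%R. Proof. by rewrite invr_ge0 fine_ge0. Qed.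
Let scaled := mscale (NngNum k0) (mrestr mu mD).

Let unif0 : unif set0 = 0.
Proof. by rewrite /uniform_law /uniform_on set0I measure0 mul0e. Qed.
Let unif_ge0 A : 0 <= unif A. Proof. exact: uniform_on_ge0. Qed.
Let unif_sigma_additive : semi_sigma_additive unif.
Proof.
move=> F mF tF mU; rewrite [X in _ --> X](_ : _ = scaled (\bigcup_n F n)).
  rewrite (_ : (fun _ => _) = (fun n => \sum_(0 <= i < n) scaled (F i))).
    exact: (measure_semi_sigma_additive F).
  by apply/funext => n; apply: eq_bigr => i _; rewrite /uniform_law uniform_onE.
by rewrite /uniform_law uniform_onE.
Qed.

HB.instance Definition _ := isMeasure.Build _ _ _ unif
  unif0 unif_ge0 unif_sigma_additive.

Let uniform_law_le1 : unif setT <= 1.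
Proof. exact: uniform_on_le1. Qed.

HB.instance Definition _ :=
  Measure_isSubProbability.Build _ _ _ unif uniform_law_le1.

Lemma ge0_integral_uniform_on (f : T -> \bar R) :
  measurable_fun setT f -> (forall x, 0 <= f x) ->
  \int[uniform_on mu D]_x f x =
  ((fine (mu D))^-1)%:E * \int[mu]_(x in D) f x.
Proof.
move=> mf f0; transitivity (\int[scaled]_x f x).
  apply: (@eq_measure_integral _ _ _ _ scaled unif) => A mA _.
  exact: uniform_onE.
rewrite ge0_integral_mscale//=; congr (_ * _).
rewrite (ge0_integral_concentrated mD)//; last first.
  by rewrite /= /mrestr setICl measure0.
by apply: eq_measure_integral => A mA AD; rewrite /= /mrestr setIidl.
Qed.

Lemma uniform_law_setT : 0 < mu D < +oo -> unif setT = 1.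
Proof.
move=> /andP[D0 Doo]; rewrite /uniform_law /uniform_on setTI divee ?gt_eqF//.
by rewrite ge0_fin_numE// ltW.
Qed.

End uniform_law.

Lemma integral_pushforward_uniform_law (R : realType) d1 d2 (T1 : measurableType d1)
    (T2 : measurableType d2) (mu : {measure set T1 -> \bar R}) (D : set T1)
    (mD : measurable D) (phi : T1 -> T2) (mphi : measurable_fun setT phi)
    (f : T2 -> \bar R) :
  measurable_fun setT f -> (forall y, 0 <= f y)%E ->
  (\int[pushforward_law (uniform_law mu mD) mphi]_y f y =
   ((fine (mu D))^-1)%:E * \int[mu]_(x in D) f (phi x))%E.
Proof.
move=> mf f0.
transitivity (\int[uniform_on mu D]_x f (phi x))%E.
  have := @ge0_integral_pushforward _ _ _ _ _ _ mphi (uniform_law mu mD)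
    setT f measurableT mf (fun x _ => f0 x).
  by rewrite preimage_setT.
rewrite (ge0_integral_uniform_on _ mD)//.
exact: (measurableT_comp mf mphi).
Qed.

(** * Geometric convergence from a Doeblin minorization *)

(** The state space is [X], but the kernel is only controlled on the set [D],
    which it does not leave. *)
Section doeblin.
Context {R : realType} {d} {X : measurableType d}.
Variables (Q : R.-ker X ~> X) (D : set X) (pi : probability X R) (eps : R).
Hypothesis mD : measurable D.
Hypothesis QT : forall x, D x -> Q x setT = 1%E.
Hypothesis QD : forall x, D x -> Q x (~` D) = 0%E.
Hypothesis eps01 : 0 < eps < 1.
Local Open Scope ereal_scope.
Hypothesis pi_inv : forall f, measurable_fun setT f -> (forall x, 0 <= f x) ->
  \int[pi]_x \int[Q x]_y f y = \int[pi]_x f x.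
Hypothesis minorization : forall f x, measurable_fun setT f ->
  (forall x, 0 <= f x) -> D x ->
  eps%:E * \int[pi]_y f y <= \int[Q x]_y \int[Q y]_z f z.

Fixpoint kernel_iter (m : nat) (x : X) : set X -> \bar R :=
  if m is k.+1 then fun A => \int[Q x]_y kernel_iter k y A else \d_x.

Let mQ f : measurable_fun setT f -> (forall x, 0 <= f x) ->
  measurable_fun setT (fun x => \int[Q x]_y f y).
Proof.
by move=> mf f0; exact: (measurable_fun_integral_kernel (measurable_kernel Q)).
Qed.

Let Q_ge0 f x : (forall x, 0 <= f x) -> 0 <= \int[Q x]_y f y.
Proof. by move=> f0; exact: integral_ge0. Qed.

Lemma kernel_iter_ge0 m x A : 0 <= kernel_iter m x A.
Proof. by elim: m x => [|m IHm] x //=; exact: integral_ge0. Qed.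

Lemma measurable_kernel_iter m A : measurable A ->
  measurable_fun setT (kernel_iter m ^~ A).
Proof.
move=> mA; elim: m => [|m IHm] /=.
  exact: measurable_fun_dirac.
by apply: mQ => // x; exact: kernel_iter_ge0.
Qed.

Lemma integral_kernel_iter m A : measurable A ->
  \int[pi]_x kernel_iter m x A = pi A.
Proof.
move=> mA; elim: m => [|m IHm] /=.
  by rewrite -[RHS](_ : \int[pi]_x (\1_A x)%:E = _)// integral_indic// setIT.
rewrite pi_inv//; first exact: measurable_kernel_iter.
by move=> x; exact: kernel_iter_ge0.
Qed.

Let integral_shift f g c x : measurable_fun setT f -> (forall x, 0 <= f x) ->
  measurable_fun setT g -> (forall x, 0 <= g x) -> (0 <= c)%R ->
  (forall y, D y -> f y = g y + c%:E) -> D x ->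
  \int[Q x]_y f y = \int[Q x]_y g y + c%:E.
Proof.
move=> mf f0 mg g0 c0 fg Dx.
transitivity (\int[Q x]_y (g y + c%:E)).
  rewrite (ge0_integral_concentrated mD (QD Dx) mf f0).
  rewrite (ge0_integral_concentrated mD (QD Dx)); last 2 first.
  - exact: emeasurable_funD.
  - by move=> y; rewrite adde_ge0// lee_fin.
  by apply: eq_integral => y; rewrite inE; exact: fg.
rewrite ge0_integralD//.
by rewrite integral_cst// QT// mule1.
Qed.

(** [f] is [c] plus a nonnegative function on [D]; the constant is preserved by
    the kernel, and the minorization applies to the rest, of mean [s - c]. *)
Lemma lower_bound_improves f c s x : measurable_fun setT f -> (forall x, 0 <= f x) ->
  (0 <= c)%R -> (forall y, D y -> c%:E <= f y) -> \int[pi]_y f y = s%:E -> D x ->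
  (c + eps * (s - c))%:E <= \int[Q x]_y \int[Q y]_z f z.
Proof.
move=> mf f0 c0 cf pif Dx.
(* the maximum only matters off [D], where nothing is known of [f] *)
pose g y := maxe (f y - c%:E) 0.
have mg : measurable_fun setT g.
  by apply: measurable_maxe => //; apply: emeasurable_funB.
have g0 y : 0 <= g y by rewrite le_max lexx orbT.
have fg y : D y -> f y = g y + c%:E.
  by move=> Dy; rewrite /g max_l ?sube_ge0 ?cf// subeK.
rewrite (@integral_shift _ (fun y => \int[Q y]_z g z) c)//; last 5 first.
- exact: mQ.
- by move=> y; exact: Q_ge0.
- exact: mQ.
- by move=> y; exact: Q_ge0.
- by move=> y Dy; exact: integral_shift.
rewrite EFinD addeC; apply: leeD2r.
apply: le_trans (minorization mg g0 Dx).
rewrite EFinM lee_pmul2l//; last by rewrite lte_fin; case/andP: eps01.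
rewrite EFinB leeBlDr// -pif.
rewrite -[X in _ + X]mule1 -(@probability_setT _ _ _ pi) -integral_cst//.
rewrite -ge0_integralD//.
apply: ge0_le_integral => //.
  exact: emeasurable_funD.
by move=> y _; rewrite -leeBlDr// le_max lexx.
Qed.

(** Induction two steps at a time: the bound after [m] steps is the constant that
    [lower_bound_improves] takes to the bound after [m + 2] steps. *)
Lemma kernel_iter_lower m x A : measurable A -> D x ->
  ((1 - (1 - eps) ^+ m./2) * fine (pi A))%:E <= kernel_iter m x A.
Proof.
move=> mA Dx; have piA : pi A = (fine (pi A))%:E by rewrite fineK// fin_num_measure.
have piA0 : (0 <= fine (pi A))%R by rewrite fine_ge0.
have [e0 e1] := andP eps01.
have [k [b ->]] : exists k (b : bool), m = (b + k.*2)%N.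
  by exists m./2, (odd m); rewrite odd_double_half.
rewrite half_bit_double; elim: k x Dx => [|k IHk] x Dx.
  by rewrite expr0 subrr mul0r kernel_iter_ge0.
rewrite doubleS !addnS/=.
apply: (le_trans _ (@lower_bound_improves (fun y => kernel_iter (b + k.*2)%N y A)
  ((1 - (1 - eps) ^+ k) * fine (pi A))%R (fine (pi A)) x _ _ _ _ _ Dx)).
- by rewrite lee_fin le_eqVlt; apply/orP; left; apply/eqP; rewrite exprS; ring.
- exact: measurable_kernel_iter.
- by move=> y; exact: kernel_iter_ge0.
- rewrite mulr_ge0// subr_ge0 exprn_ile1//; lra.
- by move=> y Dy; exact: IHk.
- by rewrite integral_kernel_iter.
Qed.

Lemma kernel_iter_setC m x A : measurable A -> D x ->
  kernel_iter m x A + kernel_iter m x (~` A) = 1.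
Proof.
move=> mA; elim: m x => [|m IHm] x Dx /=.
  by rewrite !diracE in_setC; case: (x \in A); rewrite ?adde0 ?add0e.
have mit B : measurable B -> measurable_fun setT (kernel_iter m ^~ B).
  exact: measurable_kernel_iter.
have mAC := measurableC mA.
rewrite -ge0_integralD//; [|by move=> *; exact: kernel_iter_ge0|exact: mit|
  by move=> *; exact: kernel_iter_ge0|exact: mit].
rewrite (@ge0_integral_concentrated _ _ _ (Q x) D)//; last 3 first.
- exact: QD.
- by apply: emeasurable_funD; exact: mit.
- by move=> y; rewrite adde_ge0// kernel_iter_ge0.
under eq_integral => y /[!inE] Dy do rewrite IHm//.
rewrite integral_cst// mul1e.
rewrite -(QT Dx) -(setvU D) measureU//; [|exact: measurableC|by rewrite setICl].
by rewrite [X in X + _]QD// add0e.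
Qed.

(** The lower bounds for [A] and for its complement, whose probabilities add up
    to one, give the two halves. *)
Theorem doeblin_geometric m x A : measurable A -> D x ->
  `|kernel_iter m x A - pi A| <= ((1 - eps) ^+ m./2)%:E.
Proof.
move=> mA Dx; have [e0 e1] := andP eps01.
set r := ((1 - eps) ^+ m./2)%R.
have r0 : (0 <= r)%R by rewrite exprn_ge0//; lra.
have := kernel_iter_lower m mA Dx.
have := kernel_iter_lower m (measurableC mA) Dx.
have := kernel_iter_setC m mA Dx.
have := kernel_iter_ge0 m x A; have := kernel_iter_ge0 m x (~` A).
rewrite probability_setC//.
have : pi A <= 1 := probability_le1 pi mA.
have piA0 : (0 <= fine (pi A))%R by rewrite fine_ge0.
have piA : pi A = (fine (pi A))%:E by rewrite fineK// fin_num_measure.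
rewrite piA -/r.
move: (fine (pi A)) piA0 => a a0.
case: (kernel_iter m x (~` A)) => [v| |]//; case: (kernel_iter m x A) => [u| |]//=.
rewrite !lee_fin => a1 v0 u0 [uv] h1 h2.
rewrite ler_norml.
have ra0 : (0 <= r * a)%R by rewrite mulr_ge0.
have rar : (r * a <= r)%R by rewrite ler_piMr.
apply/andP; split; lra.
Qed.

End doeblin.

(** * Euclidean norm, convex sets, compact sets *)

Section euclidean_norm.
Context {R : realType} {n : nat}.
Implicit Types u v : 'rV[R]_n.

Lemma norm2_ge0 v : 0 <= norm2 v. Proof. exact: sqrtr_ge0. Qed.

Lemma norm2Z (a : R) v : norm2 (a *: v) = `|a| * norm2 v.
Proof.
rewrite /norm2 -sqrtr_sqr -sqrtrM ?sqr_ge0//; congr Num.sqrt.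
by rewrite mulr_sumr; apply: eq_bigr => i _; rewrite mxE exprMn.
Qed.

Lemma norm2_eq0 v : (norm2 v == 0) = (v == 0).
Proof.
rewrite sqrtr_eq0; apply/idP/eqP => [v0|->]; last first.
  by rewrite big1// => i _; rewrite mxE expr0n.
have : \sum_i v 0 i ^+ 2 == 0.
  by rewrite eq_le v0/= sumr_ge0// => i _; exact: sqr_ge0.
rewrite psumr_eq0; last by move=> i _; exact: sqr_ge0.
move=> /allP vi; apply/rowP => i; rewrite mxE; apply/eqP.
by have := vi i (mem_index_enum i); rewrite /= sqrf_eq0.
Qed.

Lemma normr_coord_le_norm2 v i : `|v 0 i| <= norm2 v.
Proof.
rewrite -sqrtr_sqr ler_wsqrtr// (bigD1 i)//= lerDl sumr_ge0// => j _.
exact: sqr_ge0.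
Qed.

Lemma norm2_le v (M : R) : 0 <= M -> (forall i, `|v 0 i| <= M) ->
  norm2 v <= Num.sqrt n%:R * M.
Proof.
move=> M0 vM; rewrite -[M in leRHS]ger0_norm// -sqrtr_sqr -sqrtrM ?ler0n//.
rewrite ler_wsqrtr//.
have -> : n%:R * M ^+ 2 = \sum_(i < n) M ^+ 2 by rewrite sumr_const card_ord mulr_natl.
by apply: ler_sum => i _; rewrite -real_normK ?num_real// lerXn2r ?nnegrE.
Qed.

End euclidean_norm.

Section convex_sets.
Context {R : realType} {n : nat} (P : set 'rV[R]_n).

Definition convex_set : Prop := forall x y (s : R), P x -> P y ->
  0 <= s <= 1 -> P ((1 - s) *: x + s *: y).

Lemma convex_polytope_convex : convex_polytope P -> convex_set.
Proof.
move=> [N [v PE]] x y s;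
  rewrite PE => -[w1 [w10 w11 ->]] [w2 [w20 w21 ->]] /andP[s0 s1].
have s1' : 0 <= 1 - s by rewrite subr_ge0.
exists (fun i => (1 - s) * w1 i + s * w2 i); split.
- by move=> i; rewrite addr_ge0// mulr_ge0.
- by rewrite big_split/= -!mulr_sumr w11 w21 !mulr1 subrK.
- rewrite !scaler_sumr -big_split/=; apply: eq_bigr => i _.
  by rewrite !scalerA -scalerDl.
Qed.

Hypothesis cP : convex_set.

(** The homothety of centre [x + t v] and ratio [1 - s / t] maps a ball around
    [x] contained in [P] onto a ball around [x + s v], contained in [P] by
    convexity. *)
Lemma interior_segment x v (s t : R) : P° x -> P (x + t *: v) ->
  0 <= s < t -> P° (x + s *: v).
Proof.
move=> /nbhs_ballP[e /= e0 xeP] Py /andP[s0 st].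
have t0 : 0 < t by exact: le_lt_trans st.
set y := x + t *: v in Py.
pose r := s / t; have r0 : 0 <= r by rewrite divr_ge0// ltW.
have r1 : r < 1 by rewrite ltr_pdivrMr// mul1r.
have r1' : 0 < 1 - r by rewrite subr_gt0.
apply/nbhs_ballP; exists ((1 - r) * e) => /=; first by rewrite mulr_gt0.
move=> z; rewrite -ball_normE/= => wz.
have -> : z = (1 - r) *: (x + (1 - r)^-1 *: (z - (x + s *: v))) + r *: y.
  rewrite scalerDr scalerA mulfV ?gt_eqF// scale1r /y scalerDr scalerA.
  rewrite /r divfK ?gt_eqF// scalerBl scale1r.
  rewrite -[in LHS](subrK (x + s *: v) z).
  by apply/rowP => i; rewrite !mxE; ring.
apply: cP => //; last by rewrite r0 ltW.
apply: xeP; rewrite -ball_normE/= opprD addNKr normrN normrZ.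
by rewrite gtr0_norm ?invr_gt0// ltr_pdivrMl// distrC.
Qed.

(** On each side of [x] there is at most one boundary point, since the points
    before a point of [P] are interior. *)
Lemma line_boundary_null x v : P° x ->
  lebesgue_measure [set t : R | P (x + t *: v) /\ ~ P° (x + t *: v)] = 0%E.
Proof.
move=> Px; set S := [set t | _].
have S1 (r : R) : `|r| = 1 -> finite_set (S `&` [set t | 0 < r * t]).
  move=> r1; have rr : r * r = 1.
    by rewrite -expr2 -real_normK ?num_real// r1 expr1n.
  have half a b : S a -> S b -> 0 < r * a -> r * a < r * b -> False.
    move=> [_ Sa] [Pb _] ra ab; apply: Sa.
    have E c : x + c *: v = x + (r * c) *: (r *: v).
      by rewrite scalerA mulrAC rr mul1r.
    rewrite E; apply: (@interior_segment _ _ (r * a) (r * b)) => //.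
      by rewrite -E.
    by rewrite ab ltW.
  have [[a [Sa ra]]|/nonemptyPn ->] :=
    pselect (S `&` [set t | 0 < r * t] !=set0); last exact: finite_set0.
  apply: (@sub_finite_set _ _ [set a]); last exact: finite_set1.
  move=> b [Sb rb].
  have [ab|ba|E] := ltgtP (r * a) (r * b).
  - by case: (half _ _ Sa Sb ra ab).
  - by case: (half _ _ Sb Sa rb ba).
  - apply: (@mulfI _ r) => /=; first by rewrite -normr_eq0 r1 oner_eq0.
    exact: esym.
apply/countable_lebesgue_measure0/finite_set_countable.
apply: (@sub_finite_set _ _
  ((S `&` [set t | 0 < 1 * t]) `|` (S `&` [set t | 0 < -1 * t]))).
  move=> t St; have [t0|t0|t0] := ltgtP t 0.
  - by right; split => //=; rewrite mulN1r oppr_gt0.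
  - by left; split => //=; rewrite mul1r.
  - by case: St => _ []; rewrite t0 scale0r addr0.
by rewrite finite_setU; split; apply: S1; rewrite ?normrN normr1.
Qed.

Lemma line_length_gt0 x v : measurable P -> P° x ->
  (0 < lebesgue_measure [set t : R | P (x + t *: v)%R])%E.
Proof.
move=> mP /nbhs_ballP[e /= e0 xeP].
pose d := e / (`|v| + 1).
have v1 : 0 < `|v| + 1 by rewrite ltr_wpDl.
have d0 : 0 < d by rewrite divr_gt0.
have sub : `]0, d[ `<=` [set t : R | P (x + t *: v)].
  move=> t /=; rewrite in_itv/= => /andP[t0 td]; apply: xeP.
  rewrite -ball_normE/= opprD addNKr normrN normrZ gtr0_norm//.
  move: td; rewrite /d ltr_pdivlMr// => /(le_lt_trans _); apply.
  by rewrite ler_pM2l// lerDl.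
apply: (@lt_le_trans _ _ (lebesgue_measure (`]0, d[ : set R))).
  by rewrite lebesgue_measure_itv/= lte_fin d0 -EFinB subr0 lte_fin.
apply: le_measure => //; rewrite inE//.
rewrite -[X in measurable X]setTI; apply: measurable_rV_add => //.
exact: measurable_rV_scale.
Qed.

End convex_sets.

Section compact_sets.
Context {R : realType} {n : nat} (P : set 'rV[R]_n).

Lemma compact_measurable_rV : compact P -> measurable P.
Proof.
move=> /(compact_closed (@norm_hausdorff _ _)) cP.
rewrite -(setCK P); apply: measurableC; apply: open_measurable_rV.
exact: closed_openC.
Qed.

Lemma compact_norm2_bounded : compact P ->
  exists2 M, 0 < M & forall x y, P x -> P y -> norm2 (y - x) <= M.
Proof.
move=> /compact_bounded/ex_strict_bound_gt0[M M0 PM].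
exists (Num.sqrt n%:R * (M + M) + 1).
  by rewrite ltr_wpDl// mulr_ge0 ?sqrtr_ge0// addr_ge0// ltW.
move=> x y Px Py; apply: ler_wpDr => //; apply: norm2_le.
  by rewrite addr_ge0// ltW.
have coord z i : P z -> `|z 0 i| <= M.
  move=> Pz; apply: le_trans (ltW (PM _ Pz)).
  by rewrite /Num.norm/= mx_normrE; apply: (le_bigmax _ (fun i => `|z i.1 i.2|) (0, i)).
by move=> i; rewrite !mxE (le_trans (ler_normB _ _))// lerD//; exact: coord.
Qed.

End compact_sets.

Lemma moment_polytope_compact (R : realType) n (M : toric_manifold R n) P :
  moment_polytope M P -> compact P.
Proof.
case=> -> _ _; apply: continuous_compact; last exact: mfd_compact.
apply: continuous_subspaceT => x.
have [i xi] := cdom_cover x.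
have mc : {for cmap i x, continuous (moment (taction M) \o cinv i)}.
  by have [+ _] := moment_smooth (taction M) i 0%N; apply; exists x.
have C := continuous_comp (cmap_continuous xi) mc.
have E : moment_map M x = ((moment (taction M) \o cinv i) \o cmap i) x.
  by rewrite /= cmapK.
rewrite /continuous_at E; apply: cvg_trans C; apply: near_eq_cvg.
near=> y; rewrite /= cmapK//.
near: y; apply: open_nbhs_nbhs; split => //; exact: cdom_open.
Unshelve. all: by end_near. Qed.

(** * The hit-and-run kernel *)

(** [x^-1] is [x] times the inverse of its square, a real power of a nonnegative
    number. *)
Lemma measurable_invr (R : realType) d (T : measurableType d) (f : T -> R) :
  measurable_fun setT f -> measurable_fun setT (fun x => (f x)^-1).
Proof.
move=> mf; rewrite (_ : (fun x => _) = (fun x => f x * (f x ^+ 2) `^ (-1))).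
  apply: measurable_funM => //.
  apply: (measurableT_comp (measurable_powR (-1))); exact: measurable_funX.
apply/funext => x; rewrite powR_inv1 ?sqr_ge0//.
have [->|fx0] := eqVneq (f x) 0; first by rewrite invr0 mul0r.
by rewrite expr2 invfM mulrA mulfV// mul1r.
Qed.

Section sphere.
Context {R : realType} {n : nat}.

Definition unit_ball : set 'rV[R]_n := [set u | norm2 u <= 1].

Lemma measurable_unit_ball : measurable unit_ball.
Proof.
rewrite (_ : unit_ball = setT `&` (@norm2 R n) @^-1` `]-oo, 1]); last first.
  by rewrite setTI; apply/seteqP; split=> u /=; rewrite in_itv.
exact: measurable_norm2.
Qed.

(** The direction of the zero vector is zero, which is not a unit vector; the
    corresponding event is null. *)
Definition direction (u : 'rV[R]_n) : 'rV[R]_n := (norm2 u)^-1 *: u.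

Lemma measurable_direction : measurable_fun setT direction.
Proof.
apply: measurable_rV_scale => //; apply: measurable_invr.
exact: measurable_norm2.
Qed.

(** Convertible to [sphere_uniform n]; the name carries the measure structure. *)
Definition sphere_law : set 'rV[R]_n -> \bar R :=
  pushforward_law (uniform_law (lebesgue_rV n) measurable_unit_ball)
    measurable_direction.

HB.instance Definition _ := Measure.on sphere_law.

Let sphere_law_setT : (sphere_law setT <= 1)%E.
Proof.
exact: (uniform_on_le1 (lebesgue_rV n) measurable_unit_ball measurableT).
Qed.

HB.instance Definition _ :=
  Measure_isSubProbability.Build _ _ _ sphere_law sphere_law_setT.

Lemma integral_sphere_law (f : 'rV[R]_n -> \bar R) :
  measurable_fun setT f -> (forall v, 0 <= f v)%E ->
  (\int[sphere_law]_v f v =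
  ((fine (lebesgue_rV n unit_ball))^-1)%:E *
    \int[lebesgue_rV n]_(u in unit_ball) f (direction u))%E.
Proof.
move=> mf f0.
exact: (@integral_pushforward_uniform_law R _ _ _ _ (lebesgue_rV n) _
  measurable_unit_ball _ measurable_direction f mf f0).
Qed.

End sphere.

Section hit_and_run_kernel.
Context {R : realType} {n : nat} (P : set 'rV[R]_n).
Hypothesis mP : measurable P.

Definition line (p v : 'rV[R]_n) : set R := [set t | P (p + t *: v)].

Lemma measurable_point_on_line :
  measurable_fun setT (fun z : 'rV[R]_n * 'rV[R]_n * R => z.1.1 + z.2 *: z.1.2).
Proof.
apply: measurable_rV_add; first by apply: measurableT_comp.
by apply: measurable_rV_scale => //; apply: measurableT_comp.
Qed.

Lemma measurable_line_set (A : set 'rV[R]_n) : measurable A ->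
  measurable_fun setT (fun z : 'rV[R]_n * 'rV[R]_n =>
    lebesgue_measure [set t : R | A (z.1 + t *: z.2)%R]).
Proof.
move=> mA.
pose B := (fun z : 'rV[R]_n * 'rV[R]_n * R => z.1.1 + z.2 *: z.1.2) @^-1` A.
have mB : measurable B.
  by rewrite -[X in measurable X]setTI; exact: measurable_point_on_line.
rewrite (_ : (fun z => _) = lebesgue_measure \o xsection B); last first.
  apply/funext => z; congr lebesgue_measure.
  by apply/seteqP; split => t; rewrite /xsection/= inE.
exact: measurable_fun_xsection.
Qed.

Lemma measurable_line p v : measurable (line p v).
Proof.
rewrite -[X in measurable X]setTI.
by apply: measurable_rV_add => //; exact: measurable_rV_scale.
Qed.

Definition line_length p v : R := fine (lebesgue_measure (line p v)).

Lemma measurable_line_length :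
  measurable_fun setT (fun z : 'rV[R]_n * 'rV[R]_n => line_length z.1 z.2).
Proof.
apply: measurableT_comp => //; exact: (measurable_line_set mP).
Qed.

(** The current state may carry more than the point of [P], here the angles,
    whence the projection [base]. *)
Section kernel.
Context {d} {X : measurableType d} (base : X -> 'rV[R]_n).
Hypothesis mbase : measurable_fun setT base.

Lemma measurable_point_on_line_from (z : X * 'rV[R]_n) :
  measurable_fun setT (fun t : R => base z.1 + t *: z.2).
Proof. by apply: measurable_rV_add => //; exact: measurable_rV_scale. Qed.

Definition line_law (z : X * 'rV[R]_n) : {measure set 'rV[R]_n -> \bar R} :=
  pushforward_law (uniform_law lebesgue_measure (measurable_line (base z.1) z.2))
    (measurable_point_on_line_from z).

Let mpair : measurable_fun setT (fun z : X * 'rV[R]_n => (base z.1, z.2)).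
Proof.
apply/measurable_fun_pairP; split; last exact: measurable_snd.
exact: (measurableT_comp mbase measurable_fst).
Qed.

Lemma measurable_line_law U : measurable U ->
  measurable_fun setT (line_law ^~ U).
Proof.
move=> mU; rewrite (_ : (line_law ^~ U) = (fun z => (line_length (base z.1) z.2)^-1%:E *
   lebesgue_measure [set t | (U `&` P) (base z.1 + t *: z.2)%R])%E).
  apply: emeasurable_funM.
    apply/measurable_EFinP; apply: measurable_invr.
    exact: (measurableT_comp measurable_line_length mpair).
  exact: (measurableT_comp (measurable_line_set (measurableI _ _ mU mP)) mpair).
apply/funext => z; apply: uniform_onE; first exact: measurable_line.
by rewrite -[X in measurable X]setTI; exact: measurable_point_on_line_from.
Qed.

HB.instance Definition _ := isKernel.Build _ _ _ _ _ line_law measurable_line_law.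

Let line_law_uub : measure_fam_uub line_law.
Proof.
exists 2 => z; apply: (@le_lt_trans _ _ 1%E); last by rewrite lte_fin ltr1n.
exact: (uniform_on_le1 lebesgue_measure (measurable_line (base z.1) z.2) measurableT).
Qed.

HB.instance Definition _ := Kernel_isFinite.Build _ _ _ _ _ line_law line_law_uub.

(** The directions do not depend on the current state; as a constant kernel they
    can be composed with [line_law]. *)
Definition direction_kernel (x : X) : {measure set 'rV[R]_n -> \bar R} :=
  sphere_law.

Let measurable_direction_kernel U : measurable U ->
  measurable_fun setT (direction_kernel ^~ U).
Proof. by move=> _; exact: measurable_cst. Qed.

HB.instance Definition _ := isKernel.Build _ _ _ _ _ direction_kernel
  measurable_direction_kernel.

Let direction_kernel_uub : measure_fam_uub direction_kernel.
Proof.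
exists 2 => x; apply: (@le_lt_trans _ _ 1%E); last by rewrite lte_fin ltr1n.
exact: sprobability_setT.
Qed.

HB.instance Definition _ := Kernel_isFinite.Build _ _ _ _ _ direction_kernel
  direction_kernel_uub.

Definition hit_and_run_kernel : X -> {measure set 'rV[R]_n -> \bar R} :=
  mkcomp direction_kernel line_law.

HB.instance Definition _ := SFiniteKernel.on hit_and_run_kernel.

Lemma hit_and_run_kernelE x :
  hit_and_run_kernel x = hit_and_run P (base x) :> (set _ -> \bar R).
Proof. by []. Qed.

Lemma integral_hit_and_run_kernel x f : measurable_fun setT f ->
  (forall y, 0 <= f y)%E ->
  (\int[hit_and_run_kernel x]_y f y = \int[sphere_law]_v
    ((line_length (base x) v)^-1%:E *
     \int[lebesgue_measure]_(t in line (base x) v) f (base x + t *: v)%R))%E.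
Proof.
move=> mf f0; rewrite integral_kcomp//; apply: eq_integral => v _.
exact: integral_pushforward_uniform_law.
Qed.

End kernel.

End hit_and_run_kernel.

(** * The unit ball and the uniform law on the sphere *)

Section unit_ball_measure.
Context {R : realType} {n : nat}.
Local Notation mu := (lebesgue_rV n : set 'rV[R]_n -> \bar R).

Lemma measurable_affine_preimage (p : 'rV[R]_n) (s : R) A :
  measurable A -> measurable ((fun u => p + s *: u) @^-1` A).
Proof.
move=> mA; rewrite -[X in measurable X]setTI.
by apply: measurable_rV_add => //; exact: measurable_rV_scale.
Qed.

(** The volume of the unit ball is not computed: any bounded set of positive
    volume lies in a ball, that is an affine image of the unit ball. *)
Lemma unit_ball_measure_gt0 (P : set 'rV[R]_n) p (M : R) : measurable P ->
  0 < M -> (forall q, P q -> norm2 (q - p) <= M) ->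
  (0 < mu P)%E -> (0 < mu unit_ball)%E.
Proof.
move=> mP M0 PM; apply: contraTT; rewrite -!leNgt => B0.
have {}B0 : mu unit_ball = 0%E by apply/eqP; rewrite eq_le B0/=.
apply: (@le_trans _ _ (mu ((fun u => - M^-1 *: p + M^-1 *: u) @^-1` unit_ball))).
  apply: le_measure; rewrite ?inE//.
    apply: measurable_affine_preimage; exact: measurable_unit_ball.
  move=> q Pq; rewrite /unit_ball/= scaleNr addrC -scalerBr norm2Z.
  by rewrite gtr0_norm ?invr_gt0// mulrC ler_pdivrMr// mul1r PM.
rewrite lebesgue_rV_affine ?invr_gt0//; last exact: measurable_unit_ball.
by rewrite B0 mule0.
Qed.

(** Dually, a set of finite volume with an interior point contains a ball. *)
Lemma unit_ball_measure_lty (P : set 'rV[R]_n) : measurable P -> P° !=set0 ->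
  (mu P < +oo)%E -> (mu unit_ball < +oo)%E.
Proof.
move=> mP [p /nbhs_ballP[e /= e0 peP]] Poo.
have e2 : 0 < e / 2 by rewrite divr_gt0.
apply: (@le_lt_trans _ _ (mu ((fun u => p + (e / 2) *: u) @^-1` P))).
  apply: le_measure; rewrite ?inE//.
  - exact: measurable_unit_ball.
  - exact: measurable_affine_preimage.
  move=> u u1; apply: peP; split=> // i j; rewrite (ord1 i) /ball/= !mxE.
  rewrite opprD addNKr normrN normrM gtr0_norm//.
  have : `|u 0 j| <= 1 by exact: le_trans (normr_coord_le_norm2 u j) u1.
  move: `|u 0 j| => a a1; nra.
rewrite lebesgue_rV_affine// -ge0_fin_numE;
  last by rewrite mule_ge0// lee_fin invr_ge0 exprn_ge0// ltW.
by rewrite fin_numM// ge0_fin_numE.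
Qed.

Hypothesis n0 : (0 < n)%N.
Hypothesis B01 : (0 < mu unit_ball < +oo)%E.

Lemma measurable_rV_set1 (p : 'rV[R]_n) : measurable [set p].
Proof. apply: compact_measurable_rV; exact: compact_set1. Qed.

(** A homothety of ratio 2 fixes the point and divides the measure by [2 ^ n],
    so the measure, being finite, is zero. *)
Lemma lebesgue_rV_set1 (p : 'rV[R]_n) : mu [set p] = 0%E.
Proof.
have fin : mu [set p] \is a fin_num.
  rewrite ge0_fin_numE//; have [B0 Boo] := andP B01.
  apply: (@le_lt_trans _ _ (mu ((fun u => - p + 1 *: u) @^-1` unit_ball))).
    apply: le_measure; rewrite ?inE//.
    - exact: measurable_rV_set1.
    - apply: measurable_affine_preimage; exact: measurable_unit_ball.
    move=> _ ->; rewrite /unit_ball/= scale1r addNr.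
    by have /eqP -> : norm2 (0 : 'rV[R]_n) == 0 by rewrite norm2_eq0.
  rewrite lebesgue_rV_affine//; last exact: measurable_unit_ball.
  by rewrite expr1n invr1 mul1e.
have := @lebesgue_rV_affine R n 2 (- p) [set p] (ltr0Sn _ 1) (measurable_rV_set1 p).
have -> : (fun u => - p + 2 *: u) @^-1` [set p] = [set p].
  apply/seteqP; split=> [u /= up|_ ->/=].
    have : 2 *: u = 2 *: p by rewrite -[LHS](addKr (- p)) up opprK scaler_nat.
    by apply/scalerI; rewrite gt_eqF.
  by rewrite scaler_nat addKr.
rewrite -(fineK fin) -EFinM => -[]; move: (fine _) => a aE.
have a2 : 2 ^- n < 1 :> R by rewrite invf_lt1// exprn_egt1// ?gt_eqF// ltr1n.
have /eqP : a * (1 - 2 ^- n) = 0 by rewrite mulrBr mulr1 [a * _]mulrC -aE subrr.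
by rewrite mulf_eq0 subr_eq0 [1 == _]eq_sym (lt_eqF a2) orbF => /eqP ->.
Qed.

Lemma sphere_law_probability : @sphere_law R n setT = 1%E.
Proof.
exact: (uniform_law_setT measurable_unit_ball B01).
Qed.

Definition unit_sphere : set 'rV[R]_n := [set v | norm2 v = 1].

Lemma measurable_unit_sphere : measurable unit_sphere.
Proof.
rewrite (_ : unit_sphere = setT `&` (@norm2 R n) @^-1` [set 1]); last by rewrite setTI.
exact: measurable_norm2.
Qed.

Lemma direction_unit u : u != 0 -> unit_sphere (direction u).
Proof.
rewrite -norm2_eq0 => u0; rewrite /unit_sphere/= /direction norm2Z.
by rewrite normfV ger0_norm ?norm2_ge0// mulVf.
Qed.

Lemma sphere_law_unit_sphere : sphere_law (~` unit_sphere) = 0%E.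
Proof.
rewrite /sphere_law/= /pushforward /uniform_law uniform_onE; last 2 first.
- exact: measurable_unit_ball.
- rewrite -[X in measurable X]setTI; apply: measurable_direction => //.
  apply: measurableC; exact: measurable_unit_sphere.
apply/eqP; rewrite mule_eq0; apply/orP; right; rewrite eq_le measure_ge0 andbT.
rewrite -(lebesgue_rV_set1 0).
apply: le_measure; rewrite ?inE//.
- apply: measurableI; last exact: measurable_unit_ball.
  rewrite -[X in measurable X]setTI; apply: measurable_direction => //.
  apply: measurableC; exact: measurable_unit_sphere.
- exact: measurable_rV_set1.
move=> u [+ _]; apply: contra_notP => /eqP u0; exact: direction_unit.
Qed.

End unit_ball_measure.

(** * A lower bound in polar coordinates *)

(** Replacing the ball by the annulus below costs a constant factor, and keeps
    the change of variable from [t] to [t / norm2 u] nondegenerate. *)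
Section sphere_ray.
Context {R : realType} {n : nat}.
Local Notation mu := (lebesgue_rV n : set 'rV[R]_n -> \bar R).
Hypothesis n0 : (0 < n)%N.
Hypothesis B01 : (0 < mu unit_ball < +oo)%E.

Lemma measurable_rV_axpy d (T : measurableType d) (p v : T -> 'rV[R]_n)
    (t : T -> R) :
  measurable_fun setT p -> measurable_fun setT t -> measurable_fun setT v ->
  measurable_fun setT (fun x => p x + t x *: v x).
Proof.
by move=> mp mt mv; apply: measurable_rV_add => //; exact: measurable_rV_scale.
Qed.

Definition annulus : set 'rV[R]_n := [set u | 2^-1 <= norm2 u <= 1].

Lemma measurable_annulus : measurable annulus.
Proof.
rewrite (_ : annulus = setT `&` (@norm2 R n) @^-1` `[2^-1, 1]); last first.
  by rewrite setTI; apply/seteqP; split=> u /=; rewrite in_itv.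
exact: measurable_norm2.
Qed.

Variables (p : 'rV[R]_n) (M : R) (g : 'rV[R]_n -> \bar R).
Hypothesis M0 : 0 < M.
Hypothesis mg : measurable_fun setT g.
Hypothesis g0 : forall q, (0 <= g q)%E.
Hypothesis gM : forall q, M < norm2 (q - p) -> g q = 0%E.
Local Open Scope ereal_scope.

Let c2 : R := (2^-1 * (2 * M) ^- n.-1)%R.

Let measurable_annulus_at d (T : measurableType d) (f : T -> 'rV[R]_n) :
  measurable_fun setT f ->
  measurable_fun setT (fun x => (\1_annulus (f x))%:E : \bar R).
Proof.
move=> mf; apply/measurable_EFinP; apply: (measurableT_comp _ mf).
apply: measurable_indic; exact: measurable_annulus.
Qed.

Let measurable_halfline d (T : measurableType d) (f : T -> R) :
  measurable_fun setT f ->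
  measurable_fun setT (fun x => (\1_`]0%R, +oo[ (f x))%:E : \bar R).
Proof.
move=> mf; apply/measurable_EFinP; apply: (measurableT_comp _ mf).
exact: measurable_indic.
Qed.

(** The Jacobian of [q = p + s u] for fixed [s > 0], with the condition that
    [u] be in the annulus written in terms of [q]. *)
Let weight (z : R * 'rV[R]_n) : \bar R := (\1_`]0%R, +oo[ z.1)%:E *
  ((`|z.1| ^- n)%:E * (\1_annulus (`|z.1|^-1 *: (z.2 - p)))%:E).

Let mweight : measurable_fun setT weight.
Proof.
have mnorm : measurable_fun setT (fun z : R * 'rV[R]_n => `|z.1|%R).
  exact: (measurableT_comp (@normr_measurable R setT) measurable_fst).
apply: emeasurable_funM; first exact: measurable_halfline.
apply: emeasurable_funM.
  apply/measurable_EFinP; apply: measurable_invr; exact: measurable_funX.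
apply: measurable_annulus_at; apply: measurable_rV_scale.
  exact: measurable_invr.
by apply: measurable_rV_add.
Qed.

(** At distance [r] from [p] the radii [s] between [r] and [2 r] contribute at
    least [r * (2 r) ^- n], a nonincreasing function of [r] as [n > 0]. *)
Lemma annulus_rays_weight q : q != p -> (norm2 (q - p) <= M)%R ->
  c2%:E <= \int[lebesgue_measure]_s
    ((\1_`]0%R, +oo[ s)%:E * ((`|s| ^- n)%:E * (\1_annulus (`|s|^-1 *: (q - p)))%:E)).
Proof.
move=> qp qM; set r := norm2 (q - p) in qM *.
have r0 : (0 < r)%R by rewrite lt_neqAle eq_sym norm2_eq0 subr_eq0 qp norm2_ge0.
apply: (@le_trans _ _
    (\int[lebesgue_measure]_(s in `[r, (2 * r)%R]) ((2 * r) ^- n)%:E)).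
  rewrite integral_cst// [X in _ * X](_ : _ = r%:E); last first.
    have := @lebesgue_measure_itv R `[r, (2 * r)%R]; rewrite /= lte_fin.
    rewrite ltr_pMl// ltr1n/= -EFinB => H; apply: (etrans H).
    by congr EFin; ring.
  rewrite -EFinM lee_fin.
  rewrite /c2 -{2}(prednK n0) exprS invfM (mulrC (2 * r)^-1%R) -mulrA.
  rewrite invfM -mulrA mulVf ?gt_eqF// mulr1 mulrC.
  rewrite ler_wpM2r ?invr_ge0// lef_pV2 ?posrE ?exprn_gt0// ?mulr_gt0//.
  by rewrite lerXn2r ?nnegrE ?mulr_ge0 ?ler_pM2l// ltW.
rewrite integral_mkcond; apply: ge0_le_integral => //.
- by move=> s _; rewrite patchE; case: ifP => // _;
    rewrite lee_fin invr_ge0 exprn_ge0// mulr_ge0// ltW.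
- by apply/(measurable_restrictT _ (measurable_itv _)).
- exact: (measurableT_comp mweight (measurable_pair2 q)).
move=> s _; rewrite patchE; case: ifPn => [|_]; last first.
  by rewrite !mule_ge0// lee_fin invr_ge0 exprn_ge0.
rewrite inE/= in_itv/= => /andP[rs s2r].
have s0 : (0 < s)%R by exact: lt_le_trans rs.
rewrite !indicE gtr0_norm// (_ : s \in `]0%R, +oo[%classic);
  last by rewrite inE/= in_itv/= s0.
rewrite (_ : _ \in annulus) ?mul1e ?mule1; last first.
  rewrite inE /annulus/= norm2Z gtr0_norm ?invr_gt0// -/r.
  by rewrite ler_pdivlMl// ler_pdivrMl// mulr1 rs andbT ler_pdivrMr// mulrC.
by rewrite lee_fin lef_pV2 ?posrE ?exprn_gt0// ?mulr_gt0// lerXn2r ?nnegrE//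
  ?mulr_ge0// ltW.
Qed.

Let along_ray (z : 'rV[R]_n * R) : \bar R :=
  (\1_annulus z.1)%:E * ((\1_`]0%R, +oo[ z.2)%:E * g (p + z.2 *: z.1)%R).

Let malong_ray : measurable_fun setT along_ray.
Proof.
apply: emeasurable_funM; first exact: measurable_annulus_at.
apply: emeasurable_funM; first exact: measurable_halfline.
by apply: (measurableT_comp mg); exact: measurable_rV_axpy.
Qed.

Let along_ray_ge0 z : 0 <= along_ray z.
Proof. by rewrite !mule_ge0// lee_fin. Qed.

Let weight_ge0 z : 0 <= weight z.
Proof. by rewrite !mule_ge0// lee_fin invr_ge0 exprn_ge0. Qed.

Let integral_along_ray s :
  \int[mu]_u along_ray (u, s) = \int[mu]_q (weight (s, q) * g q).
Proof.
rewrite /along_ray /weight/=.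
have [s0|s0] := ltP 0%R s; last first.
  have -> : \1_`]0%R, +oo[ s = 0%R :> R.
    have sN : s \in `]0%R, +oo[%classic = false.
      by apply/negbTE/negP; rewrite inE/= in_itv/= andbT ltNge s0.
    by rewrite indicE sN.
  transitivity (0 : \bar R); [|apply/esym]; apply: integral0_eq => q _;
    by rewrite !(mul0e, mule0).
rewrite indicE mem_set/= ?in_itv/= ?s0// gtr0_norm//.
under eq_integral do rewrite mul1e.
under [RHS]eq_integral do rewrite mul1e -muleA.
pose h q := (\1_annulus (s^-1 *: (q - p)))%:E * g q.
have mh : measurable_fun setT h.
  apply: emeasurable_funM => //; apply: measurable_annulus_at.
  by apply: measurable_rV_scale => //; exact: measurable_rV_add.
have h0 q : 0 <= h q by rewrite mule_ge0// lee_fin.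
have sn0 : 0 <= (s ^- n)%:E by rewrite lee_fin invr_ge0 exprn_ge0// ltW.
rewrite (@ge0_integralZl _ _ _ mu setT measurableT h mh _ (fun q _ => h0 q) sn0).
rewrite -(ge0_integral_rV_affine p s0 mh h0); apply: eq_integral => u _.
by rewrite /h [(p + _)%R]addrC addrK scalerA mulVf ?gt_eqF// scale1r.
Qed.

(** For fixed [s] the variable [u] is replaced by [q = p + s u]; then the
    integrals over [s] and [q] are exchanged. *)
Lemma annulus_rays_lower : c2%:E * \int[mu]_q g q <=
  \int[mu]_u ((\1_annulus u)%:E *
    \int[lebesgue_measure]_s ((\1_`]0%R, +oo[ s)%:E * g (p + s *: u)%R)).
Proof.
have mgs : measurable_fun setT (fun z : R * 'rV[R]_n => weight z * g z.2).
  by apply: emeasurable_funM => //; exact: (measurableT_comp mg measurable_snd).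
have gs0 z : 0 <= weight z * g z.2 by rewrite mule_ge0.
have -> : \int[mu]_u ((\1_annulus u)%:E *
    \int[lebesgue_measure]_s ((\1_`]0%R, +oo[ s)%:E * g (p + s *: u)%R)) =
    \int[mu]_u \int[lebesgue_measure]_s along_ray (u, s).
  apply: eq_integral => u _; rewrite -ge0_integralZl//.
  - apply: emeasurable_funM; first exact: measurable_halfline.
    by apply: (measurableT_comp mg); exact: measurable_rV_axpy.
  - by move=> s _; rewrite mule_ge0// lee_fin.
have -> : \int[mu]_u \int[lebesgue_measure]_s along_ray (u, s) =
    \int[mu]_q \int[lebesgue_measure]_s (weight (s, q) * g q).
  transitivity (\int[lebesgue_measure]_s \int[mu]_u along_ray (u, s)).
    exact: (@fubini_tonelli _ _ _ _ R (lebesgue_rV n) lebesgue_measure).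
  transitivity (\int[lebesgue_measure]_s \int[mu]_q (weight (s, q) * g q)).
    by apply: eq_integral => s _; exact: integral_along_ray.
  exact: (@fubini_tonelli _ _ _ _ R lebesgue_measure (lebesgue_rV n) _ mgs gs0).
have mW : measurable_fun setT (fun q => \int[lebesgue_measure]_s weight (s, q)).
  exact: (@measurable_fun_fubini_tonelli_G _ _ _ _ R lebesgue_measure weight
    mweight weight_ge0).
under [leRHS]eq_integral => q _.
  rewrite ge0_integralZr//; last exact: (measurableT_comp mweight (measurable_pair2 q)).
  over.
have W0 q : 0 <= \int[lebesgue_measure]_s weight (s, q) by exact: integral_ge0.
have c20 : 0 <= c2%:E by rewrite lee_fin mulr_ge0// invr_ge0 exprn_ge0// mulr_ge0// ltW.
rewrite -ge0_integralZl//.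
(* the weight vanishes at [q = p], a null set *)
have mDp : measurable (~` [set p]) by apply: measurableC; exact: measurable_rV_set1.
have Dp0 : mu (~` (~` [set p])) = 0 by rewrite setCK; exact: lebesgue_rV_set1.
rewrite (ge0_integral_concentrated mDp Dp0);
  [|exact: measurable_funeM|by move=> q; rewrite mule_ge0].
rewrite (ge0_integral_concentrated mDp Dp0);
  [|exact: emeasurable_funM|by move=> q; rewrite mule_ge0].
apply: ge0_le_integral => //.
- by move=> q _; rewrite mule_ge0.
- by apply: measurable_funTS; exact: measurable_funeM.
- by apply: measurable_funTS; exact: emeasurable_funM.
move=> q /eqP qp; have [qM|qM] := leP (norm2 (q - p)) M.
  by rewrite lee_wpmul2r//; exact: annulus_rays_weight.
by rewrite gM// !mule0.
Qed.

(** The factors are the normalization of the uniform law on the ball, the bound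
    of [full_ray_direction] and that of [annulus_rays_weight]. *)
Definition polar_constant : R :=
  (fine (mu unit_ball))^-1 * (2^-1 * (2^-1 * (2 * M) ^- n.-1)).

Lemma polar_constant_gt0 : (0 < polar_constant)%R.
Proof.
have [B0 Boo] := andP B01.
have b0 : (0 < fine (mu unit_ball))%R by rewrite fine_gt0// B0.
by rewrite !mulr_gt0 ?invr_gt0 ?exprn_gt0 ?mulr_gt0.
Qed.

Let full_ray v : \bar R := \int[lebesgue_measure]_t g (p + t *: v)%R.

Let mfull_ray : measurable_fun setT full_ray.
Proof.
have mf : measurable_fun setT (fun z : 'rV[R]_n * R => g (p + z.2 *: z.1)%R).
  by apply: (measurableT_comp mg); exact: measurable_rV_axpy.
exact: (@measurable_fun_fubini_tonelli_F _ _ _ _ R lebesgue_measure _ mf).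
Qed.

Let half_ray u : \bar R :=
  \int[lebesgue_measure]_s ((\1_`]0%R, +oo[ s)%:E * g (p + s *: u)%R).

Let mhalf_ray : measurable_fun setT half_ray.
Proof.
have mf : measurable_fun setT (fun z : 'rV[R]_n * R =>
    (\1_`]0%R, +oo[ z.2)%:E * g (p + z.2 *: z.1)%R).
  apply: emeasurable_funM; first exact: measurable_halfline.
  by apply: (measurableT_comp mg); exact: measurable_rV_axpy.
apply: (@measurable_fun_fubini_tonelli_F _ _ _ _ R lebesgue_measure _ mf).
by move=> z; rewrite mule_ge0// lee_fin.
Qed.

(** On a line, changing [u] into its direction multiplies the integral by
    [norm2 u], at least [1 / 2] on the annulus. *)
Let full_ray_direction u : annulus u -> 2^-1%:E * half_ray u <= full_ray (direction u).
Proof.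
move=> /andP[u2 _]; have u0 : (0 < norm2 u)%R by exact: lt_le_trans u2.
have mG : measurable_fun setT (fun t : R => g (p + t *: u)%R).
  by apply: (measurableT_comp mg); exact: measurable_rV_axpy.
rewrite (_ : full_ray _ = (norm2 u)%:E * \int[lebesgue_measure]_t g (p + t *: u)%R).
  apply: lee_pmul => //; first by apply: integral_ge0 => s _;
    rewrite mule_ge0// lee_fin.
  apply: ge0_le_integral => //.
  - by move=> s _; rewrite mule_ge0// lee_fin.
  - by apply: emeasurable_funM => //; exact: measurable_halfline.
  move=> s _; rewrite indicE; case: (_ \in _); rewrite ?mul1e// mul0e.
  exact: g0.
have ui0 : ((norm2 u)^-1 != 0)%R by rewrite invr_eq0 gt_eqF.
have := @ge0_integral_affine R (norm2 u)^-1%R 0%R _ ui0 mG (fun t => g0 _).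
rewrite normfV invrK gtr0_norm// => <-.
by apply: eq_integral => t _; rewrite addr0 /direction scalerA mulrC.
Qed.

(** The part of polar integration used here: averaging over directions the
    integral of [g] along the line through [p] dominates a multiple of the
    integral of [g], when [g] vanishes at distance more than [M] from [p]. *)
Lemma sphere_rays_lower : polar_constant%:E * \int[mu]_q g q <=
  \int[sphere_law]_v \int[lebesgue_measure]_t g (p + t *: v)%R.
Proof.
have full_ray_ge0 v : 0 <= full_ray v by exact: integral_ge0.
have half_ray_ge0 u : 0 <= half_ray u.
  by apply: integral_ge0 => s _; rewrite mule_ge0// lee_fin.
have := integral_sphere_law mfull_ray full_ray_ge0; rewrite /full_ray => ->.
rewrite /polar_constant EFinM -muleA; apply: lee_wpmul2l.
  by rewrite lee_fin invr_ge0 fine_ge0.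
rewrite EFinM -muleA.
apply: (@le_trans _ _ (2^-1%:E * \int[mu]_u ((\1_annulus u)%:E * half_ray u))).
  by apply: lee_wpmul2l; [rewrite lee_fin|exact: annulus_rays_lower].
have mah : measurable_fun setT (fun u => (\1_annulus u)%:E * half_ray u).
  by apply: emeasurable_funM => //; exact: measurable_annulus_at.
rewrite -ge0_integralZl//; last by move=> u _; rewrite mule_ge0// lee_fin.
rewrite [leRHS]integral_mkcond; apply: ge0_le_integral => //.
- by move=> u _; rewrite !mule_ge0// lee_fin.
- exact: measurable_funeM.
- apply/(measurable_restrictT _ measurable_unit_ball).
  apply: measurable_funTS; exact: (measurableT_comp mfull_ray measurable_direction).
move=> u _; rewrite indicE; have [|ua] := boolP (u \in annulus); last first.
  by rewrite mul0e mule0; apply: erestrict_ge0 => v _; exact: full_ray_ge0.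
rewrite inE mul1e patchE => ua; rewrite mem_set; first exact: full_ray_direction.
by case/andP: ua.
Qed.

End sphere_ray.

(** * Invariance and minorization of hit-and-run *)

Section hit_and_run_chain.
Context {R : realType} {n : nat} (P : set 'rV[R]_n) (M : R).
Local Notation mu := (lebesgue_rV n : set 'rV[R]_n -> \bar R).
Hypothesis n0 : (0 < n)%N.
Hypothesis mP : measurable P.
Hypothesis cP : convex_set P.
Hypothesis M0 : 0 < M.
Hypothesis PM : forall p q, P p -> P q -> norm2 (q - p) <= M.
Hypothesis P01 : (0 < mu P < +oo)%E.
Hypothesis Pint : P° !=set0.
Hypothesis boundary0 : mu (P `\` P°) = 0%E.
Local Open Scope ereal_scope.

Lemma unit_ball_measure_bounds : 0 < mu (@unit_ball R n) < +oo.
Proof.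
have [P0 Poo] := andP P01; have [p Pp] := Pint; apply/andP; split.
  apply: (@unit_ball_measure_gt0 _ _ P p M) => // q; apply: PM.
  exact: interior_subset.
exact: (unit_ball_measure_lty mP).
Qed.

Let B01 := unit_ball_measure_bounds.

Let mPo : measurable P°.
Proof. apply: open_measurable_rV; exact: open_interior. Qed.

Lemma line_measure_bounds p v : P° p -> unit_sphere v ->
  0 < lebesgue_measure (line P p v) <= (2 * M)%:E.
Proof.
move=> Pp v1; rewrite (line_length_gt0 _ mP Pp)/=.
have -> : (2 * M)%:E = lebesgue_measure (`[(- M)%R, M] : set R).
  rewrite lebesgue_measure_itv/= lte_fin.
  rewrite (_ : (- M < M)%R); last by rewrite gt0_cp.
  by rewrite -EFinB; congr EFin; ring.
apply: le_measure; rewrite ?inE//; first exact: measurable_line.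
move=> t Pt /=; rewrite in_itv/= -ler_norml.
have := PM (interior_subset Pp) Pt.
by rewrite addrC addKr norm2Z (_ : norm2 v = 1%R)// mulr1.
Qed.

Lemma line_length_bounds p v : P° p -> unit_sphere v ->
  (0 < line_length P p v <= 2 * M)%R.
Proof.
move=> Pp v1; have /andP[l0 lM] := line_measure_bounds Pp v1.
have lfin : lebesgue_measure (line P p v) \is a fin_num.
  by rewrite ge0_fin_numE// (le_lt_trans lM) ?ltry.
by rewrite /line_length -!lte_fin -!lee_fin fineK// l0.
Qed.

Let mfP f : measurable_fun setT f -> measurable_fun setT (f \_ P : _ -> \bar R).
Proof.
by move=> mf; apply/(measurable_restrictT _ mP); exact: measurable_funTS.
Qed.

Let fP_ge0 f : (forall q, 0 <= f q) -> forall q, 0 <= (f \_ P : _ -> \bar R) q.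
Proof. by move=> f0 q; apply: erestrict_ge0. Qed.

Lemma integral_hit_and_run p (f : 'rV[R]_n -> \bar R) :
  measurable_fun setT f -> (forall q, 0 <= f q) ->
  \int[hit_and_run P p]_q f q = \int[sphere_law]_v
    ((line_length P p v)^-1%:E *
     \int[lebesgue_measure]_t (f \_ P) (p + t *: v)%R).
Proof.
move=> mf f0.
rewrite -(@hit_and_run_kernelE _ _ _ mP _ _ _ (@measurable_id _ _ [set: 'rV[R]_n]) p).
rewrite integral_hit_and_run_kernel//; apply: eq_integral => v _; congr (_ * _).
rewrite integral_mkcond; apply: eq_integral => t _; rewrite !patchE.
by congr (if _ then _ else _); apply/idP/idP; rewrite !inE.
Qed.

Let mray (f : 'rV[R]_n -> \bar R) (v p : 'rV[R]_n) : measurable_fun setT f ->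
  measurable_fun setT (fun t : R => f (p + t *: v)%R : \bar R).
Proof. by move=> mf; apply: (measurableT_comp mf); exact: measurable_rV_axpy. Qed.

Let integral_rays f : measurable_fun setT f -> (forall q, 0 <= f q) ->
  measurable_fun setT (fun z : 'rV[R]_n * 'rV[R]_n =>
    \int[lebesgue_measure]_t (f (z.1 + t *: z.2)%R : \bar R)).
Proof.
move=> mf f0.
have mF : measurable_fun setT
    (fun w : ('rV[R]_n * 'rV[R]_n) * R => f (w.1.1 + w.2 *: w.1.2)%R).
  apply: (measurableT_comp mf); exact: measurable_point_on_line.
exact: (@measurable_fun_fubini_tonelli_F _ _ _ _ R lebesgue_measure _ mF).
Qed.

Let mdensity f : measurable_fun setT f -> (forall q, 0 <= f q) ->
  measurable_fun setT (fun z : 'rV[R]_n * 'rV[R]_n =>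
    (line_length P z.1 z.2)^-1%:E *
    \int[lebesgue_measure]_t (f (z.1 + t *: z.2)%R : \bar R)).
Proof.
move=> mf f0; apply: emeasurable_funM; last exact: integral_rays.
apply/measurable_EFinP; apply: measurable_invr; exact: measurable_line_length.
Qed.

Let density_ge0 f p v : (forall q, 0 <= f q) ->
  0 <= (line_length P p v)^-1%:E *
    \int[lebesgue_measure]_t (f (p + t *: v)%R : \bar R).
Proof.
move=> f0; rewrite mule_ge0//; first by rewrite lee_fin invr_ge0 fine_ge0.
exact: integral_ge0.
Qed.

Let integral_sphere_unit h : measurable_fun setT h -> (forall v, 0 <= h v) ->
  \int[@sphere_law R n]_v h v = \int[sphere_law]_(v in unit_sphere) h v.
Proof.
move=> mh h0; apply: ge0_integral_concentrated => //.
  exact: measurable_unit_sphere.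
exact: sphere_law_unit_sphere.
Qed.

(** A chord has length at most [2 * M], so dividing by its length loses at most
    that factor compared with [sphere_rays_lower]. *)
Lemma hit_and_run_minorization p (f : 'rV[R]_n -> \bar R) : P° p ->
  measurable_fun setT f -> (forall q, 0 <= f q) ->
  ((2 * M)^-1 * @polar_constant R n M)%:E * \int[mu]_(q in P) f q <=
  \int[hit_and_run P p]_q f q.
Proof.
move=> Pp mf f0; rewrite integral_hit_and_run//.
have mg := mfP mf; have g0 := fP_ge0 f0; set g := f \_ P in mg g0 *.
rewrite integral_mkcond -/g.
have mdens : measurable_fun setT (fun v : 'rV[R]_n =>
    (line_length P p v)^-1%:E * \int[lebesgue_measure]_t g (p + t *: v)%R).
  exact: (measurableT_comp (mdensity mg g0) (measurable_pair1 p)).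
have mray_p : measurable_fun setT (fun v : 'rV[R]_n =>
    \int[lebesgue_measure]_t g (p + t *: v)%R).
  exact: (measurableT_comp (integral_rays mg g0) (measurable_pair1 p)).
have ray_ge0 v : 0 <= \int[lebesgue_measure]_t g (p + t *: v)%R.
  exact: integral_ge0.
have c0 : 0 <= ((2 * M)^-1)%:E by rewrite lee_fin invr_ge0 mulr_ge0// ltW.
rewrite EFinM -muleA.
apply: (@le_trans _ _ (((2 * M)^-1)%:E *
    \int[sphere_law]_v \int[lebesgue_measure]_t g (p + t *: v)%R)).
  apply: lee_wpmul2l => //; apply: sphere_rays_lower => // q Mq.
  rewrite /g patchE memNset// => Pq.
  by move: Mq; rewrite ltNge (PM (interior_subset Pp) Pq).
have mcray := measurable_funeM (2 * M)^-1%:E mray_p.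
rewrite -ge0_integralZl// (integral_sphere_unit mcray);
  last by move=> v; rewrite mule_ge0.
rewrite [leRHS](integral_sphere_unit mdens); last by move=> v; exact: density_ge0.
apply: ge0_le_integral => //.
- exact: measurable_unit_sphere.
- by move=> v _; rewrite mule_ge0.
- exact: measurable_funTS.
- exact: measurable_funTS.
move=> v v1; have /andP[l0 lM] := line_length_bounds Pp v1.
by rewrite lee_wpmul2r// lee_fin lef_pV2// posrE mulr_gt0.
Qed.

Lemma line_length_shift p v (t : R) :
  line_length P (p + t *: v) v = line_length P p v.
Proof.
rewrite /line_length; congr fine.
transitivity (lebesgue_measure ((fun s : R => 1 * s + t)%R @^-1` line P p v)).
  congr lebesgue_measure; apply/funext => s; rewrite /line/= mul1r.
  by rewrite scalerDl -addrA [in LHS](addrC (t *: v)).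
rewrite lebesgue_measure_affine ?oner_eq0//; last exact: measurable_line.
by rewrite normr1 invr1 mul1e.
Qed.

Let mchi : measurable_fun setT (fun q : 'rV[R]_n => (\1_P q)%:E : \bar R).
Proof. by apply/measurable_EFinP; exact: measurable_indic. Qed.

Let chi_ge0 (q : 'rV[R]_n) : 0 <= (\1_P q)%:E :> \bar R.
Proof. by rewrite lee_fin. Qed.

Lemma integral_line_backward q v :
  \int[lebesgue_measure]_t (\1_P (q - t *: v)%R)%:E =
  lebesgue_measure (line P q v).
Proof.
have N1 : ((-1 : R) != 0)%R by rewrite oppr_eq0 oner_eq0.
have := @ge0_integral_affine R (-1)%R 0%R _ N1 (mray v q mchi) (fun t => chi_ge0 _).
rewrite normrN normr1 invr1 mul1e => E.
transitivity (\int[lebesgue_measure]_t (\1_P (q + t *: v)%R)%:E).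
  rewrite -E; apply: eq_integral => t _.
  by rewrite addr0 mulN1r scaleNr.
transitivity (\int[lebesgue_measure]_t (\1_(line P q v) t)%:E); last first.
  by rewrite integral_indic ?setIT//; exact: measurable_line.
apply: eq_integral => t _; rewrite !indicE; congr (_%:R%:E).
Qed.

(** For a fixed direction the hit-and-run step moves [p] to [q = p + t v]; with
    [q] and [t] as variables, the chord through [p] is the chord through [q], and
    the integral over [t] is the length of that chord. *)
Lemma line_average_invariant (g : 'rV[R]_n -> \bar R) v : unit_sphere v ->
  measurable_fun setT g -> (forall q, 0 <= g q) -> (forall q, ~ P q -> g q = 0) ->
  \int[mu]_p ((\1_P p)%:E * ((line_length P p v)^-1%:E *
    \int[lebesgue_measure]_t g (p + t *: v)%R)) = \int[mu]_q g q.
Proof.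
move=> v1 mg g0 gP.
pose w q : \bar R := ((line_length P q v)^-1)%:E.
have mw : measurable_fun setT w.
  apply/measurable_EFinP; apply: measurable_invr.
  exact: (measurableT_comp (measurable_line_length mP) (measurable_pair2 v)).
have w0 q : 0 <= w q by rewrite lee_fin invr_ge0 fine_ge0.
pose G (z : 'rV[R]_n * R) := (\1_P z.1)%:E * (w z.1 * g (z.1 + z.2 *: v)%R).
pose K (z : R * 'rV[R]_n) := (\1_P (z.2 - z.1 *: v)%R)%:E * (w z.2 * g z.2).
have mG : measurable_fun setT G.
  apply: emeasurable_funM; first exact: (measurableT_comp mchi measurable_fst).
  apply: emeasurable_funM; first exact: (measurableT_comp mw measurable_fst).
  by apply: (measurableT_comp mg); exact: measurable_rV_axpy.
have G0 z : 0 <= G z by rewrite !mule_ge0.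
have mK : measurable_fun setT K.
  apply: emeasurable_funM.
    rewrite (_ : (fun x => _) = (fun q : 'rV[R]_n => (\1_P q)%:E : \bar R) \o
      (fun x : R * 'rV[R]_n => x.2 + (- x.1) *: v)%R); last first.
      by apply/funext => x; rewrite /= scaleNr.
    apply: (measurableT_comp mchi); apply: measurable_rV_axpy => //.
    exact: (measurableT_comp (@oppr_measurable R setT) measurable_fst).
  by apply: (measurableT_comp (f := fun q => w q * g q)) => //; exact: emeasurable_funM.
have K0 z : 0 <= K z by rewrite !mule_ge0.
transitivity (\int[mu]_p \int[lebesgue_measure]_t G (p, t)).
  apply: eq_integral => p _; rewrite -ge0_integralZl//; [|exact: mray|exact: w0].
  rewrite -ge0_integralZl//; first by apply: measurable_funeM; exact: mray.
  by move=> t _; exact: mule_ge0 (w0 p) (g0 _).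
transitivity (\int[lebesgue_measure]_t \int[mu]_p G (p, t)).
  exact: (@fubini_tonelli _ _ _ _ R (lebesgue_rV n) lebesgue_measure).
transitivity (\int[lebesgue_measure]_t \int[mu]_q K (t, q)).
  apply: eq_integral => t _.
  have mKt := measurableT_comp mK (measurable_pair1 t).
  have := @ge0_integral_rV_affine R n 1 (t *: v) _ ltr01 mKt (fun q => K0 _).
  rewrite expr1n invr1 mul1e => E; apply: (etrans _ E).
  apply: eq_integral => p _; rewrite /K /G /w/= scale1r.
  by rewrite [(t *: v + p)%R]addrC addrK line_length_shift.
transitivity (\int[mu]_q \int[lebesgue_measure]_t K (t, q)).
  exact: (@fubini_tonelli _ _ _ _ R lebesgue_measure (lebesgue_rV n)).
have mIK : measurable_fun setT (fun q => \int[lebesgue_measure]_t K (t, q)).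
  exact: (@measurable_fun_fubini_tonelli_G _ _ _ _ R lebesgue_measure K mK K0).
(* outside the null set of boundary points every chord has positive length *)
have mD : measurable (~` (P `\` P°)) by apply: measurableC; exact: measurableD.
have D0 : mu (~` ~` (P `\` P°)) = 0 by rewrite setCK.
rewrite (ge0_integral_concentrated mD D0 mIK); last by move=> q; exact: integral_ge0.
rewrite [RHS](ge0_integral_concentrated mD D0 mg g0).
apply: eq_integral => q; rewrite inE => Dq.
have mback : measurable_fun setT (fun t : R => (\1_P (q - t *: v)%R)%:E : \bar R).
  apply: (measurableT_comp mchi); apply: measurable_rV_add => //.
  apply: measurable_rV_opp; exact: measurable_rV_scale.
rewrite /K/= ge0_integralZr//; last by rewrite mule_ge0.
rewrite integral_line_backward.
have [Pq|nPq] := pselect (P q); last by rewrite gP// !mule0.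
have Poq : P° q by apply: contrapT => nPoq; exact: Dq.
have /andP[l0 lM] := line_measure_bounds Poq v1.
have lfin : lebesgue_measure (line P q v) \is a fin_num.
  by rewrite ge0_fin_numE// (le_lt_trans lM) ?ltry.
rewrite muleA /w /line_length -{1}(fineK lfin) -EFinM mulfV ?mul1e//.
by rewrite gt_eqF// fine_gt0// l0 (le_lt_trans lM) ?ltry.
Qed.

Lemma hit_and_run_invariant (f : 'rV[R]_n -> \bar R) :
  measurable_fun setT f -> (forall q, 0 <= f q) ->
  \int[mu]_(p in P) \int[hit_and_run P p]_q f q = \int[mu]_(q in P) f q.
Proof.
move=> mf f0; rewrite [RHS]integral_mkcond.
have mg := mfP mf; have g0 := fP_ge0 f0.
have gP q : ~ P q -> (f \_ P) q = 0 by move=> nPq; rewrite patchE memNset.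
transitivity (\int[mu]_(p in P) \int[sphere_law]_v ((line_length P p v)^-1%:E *
     \int[lebesgue_measure]_t (f \_ P) (p + t *: v)%R)).
  by apply: eq_integral => p _; exact: integral_hit_and_run.
set g := f \_ P in mg g0 gP *.
pose F (z : 'rV[R]_n * 'rV[R]_n) := (\1_P z.1)%:E *
  ((line_length P z.1 z.2)^-1%:E *
     \int[lebesgue_measure]_t g (z.1 + t *: z.2)%R).
have mF : measurable_fun setT F.
  apply: emeasurable_funM; last exact: mdensity.
  exact: (measurableT_comp mchi measurable_fst).
have F0 z : 0 <= F z by apply: mule_ge0 => //; exact: density_ge0.
transitivity (\int[mu]_p \int[sphere_law]_v F (p, v)).
  rewrite integral_mkcond; apply: eq_integral => p _; rewrite patchE /F/= indicE.
  case: (p \in P); last by rewrite integral0_eq// => v _; rewrite mul0e.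
  by apply: eq_integral => v _; rewrite mul1e.
transitivity (\int[sphere_law]_v \int[mu]_p F (p, v)).
  exact: (@fubini_tonelli _ _ _ _ R (lebesgue_rV n) sphere_law).
have mIF : measurable_fun setT (fun v => \int[mu]_p F (p, v)).
  exact: (@measurable_fun_fubini_tonelli_G _ _ _ _ R (lebesgue_rV n) F mF F0).
rewrite (integral_sphere_unit mIF); last by move=> v; exact: integral_ge0.
transitivity (\int[@sphere_law R n]_(v in unit_sphere) cst (\int[mu]_q g q) v).
  by apply: eq_integral => v; rewrite inE => v1; exact: line_average_invariant.
have c0 : 0 <= \int[mu]_q g q by exact: integral_ge0.
rewrite -(integral_sphere_unit (measurable_cst _) (fun _ => c0)).
rewrite integral_cst// -[RHS]mule1; congr (_ * _).
exact: sphere_law_probability.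
Qed.

Let hit_and_run_on_sphere p A : measurable A ->
  hit_and_run P p A = \int[sphere_law]_(v in unit_sphere)
    uniform_on lebesgue_measure (line P p v) [set t | A (p + t *: v)%R].
Proof.
move=> mA; rewrite -integral_sphere_unit//.
  have mid := @measurable_id _ _ [set: 'rV[R]_n].
  exact: (measurableT_comp (measurable_line_law mP mid mA) (measurable_pair1 p)).
by move=> v; exact: uniform_on_ge0.
Qed.

Lemma hit_and_run_setT p : P° p -> hit_and_run P p setT = 1.
Proof.
move=> Pp; rewrite hit_and_run_on_sphere//.
transitivity (\int[@sphere_law R n]_(v in unit_sphere) cst 1 v).
  apply: eq_integral => v; rewrite inE => v1.
  have /andP[l0 lM] := line_measure_bounds Pp v1.
  have l01 : 0 < lebesgue_measure (line P p v) < +oo.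
    by rewrite l0 (le_lt_trans lM) ?ltry.
  exact: (@uniform_law_setT _ _ _ lebesgue_measure _ (measurable_line mP p v) l01).
rewrite -(integral_sphere_unit (measurable_cst _) (fun _ => lee01)).
rewrite integral_cst// -[RHS]mule1; congr (_ * _).
exact: sphere_law_probability.
Qed.

Lemma hit_and_run_stays_inside p : P° p -> hit_and_run P p (~` P°) = 0.
Proof.
move=> Pp; rewrite hit_and_run_on_sphere//; last exact: measurableC.
apply: integral0_eq => v _; rewrite uniform_onE.
- rewrite (_ : _ `&` _ = [set t : R | P (p + t *: v)%R /\ ~ P° (p + t *: v)%R]).
    rewrite [X in _ * X](_ : _ = 0) ?mule0//; exact: (line_boundary_null cP v Pp).
  by apply/seteqP; split => t [].
- exact: measurable_line.
- rewrite -[X in measurable X]setTI.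
  by apply: measurable_rV_axpy => //; exact: measurableC.
Qed.

End hit_and_run_chain.

(** * The kernel of the toric chain *)

Section torus_law.
Context {R : realType} {n : nat}.

Definition fundamental_cube : set 'rV[R]_n :=
  [set s | forall i, 0 <= s 0 i < 2 * pi].

Lemma measurable_fundamental_cube : measurable fundamental_cube.
Proof.
rewrite (_ : fundamental_cube = \bigcap_(i in [set: 'I_n])
    ((fun s : 'rV[R]_n => s 0 i) @^-1` `[0, 2 * pi[)); last first.
  apply/seteqP; split=> [s s01 i _ /=|s s01 i]; first by rewrite in_itv/= s01.
  by have := s01 i I; rewrite /= in_itv.
apply: fin_bigcap_measurable => [|i _]; first exact: finite_finset.
by rewrite -[X in measurable X]setTI; apply: measurable_mx_entry.
Qed.

Lemma measurable_circle_proj : measurable_fun setT (@circle_proj R).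
Proof. by move=> _ B mB; rewrite setTI. Qed.

Lemma measurable_torus_proj : measurable_fun setT (@torus_proj R n).
Proof.
apply: measurable_fun_mx => i j; under eq_fun do rewrite mxE.
exact: (measurableT_comp measurable_circle_proj (measurable_mx_entry i j)).
Qed.

(** Convertible to [torus_uniform]; the name carries the measure structure. *)
Definition torus_law : set (torus R n) -> \bar R :=
  pushforward_law (uniform_law (lebesgue_rV n) measurable_fundamental_cube)
    measurable_torus_proj.

HB.instance Definition _ := Measure.on torus_law.

Let torus_law_setT : (torus_law setT <= 1)%E.
Proof.
exact: (uniform_on_le1 (lebesgue_rV n) measurable_fundamental_cube measurableT).
Qed.

HB.instance Definition _ :=
  Measure_isSubProbability.Build _ _ _ torus_law torus_law_setT.

End torus_law.

Section step_kernel.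
Context {R : realType} {n : nat} (P : set 'rV[R]_n) (beta : R).
Hypothesis mP : measurable P.
Hypothesis beta01 : 0 < beta < 1.
Local Notation X := ('rV[R]_n * torus R n)%type.
Local Open Scope ereal_scope.

Let beta0 : (0 <= beta)%R. Proof. by case/andP: beta01 => /ltW. Qed.
Let beta1 : (0 <= 1 - beta)%R.
Proof. by rewrite subr_ge0; case/andP: beta01 => _ /ltW. Qed.

Let hr := hit_and_run_kernel mP (@measurable_fst _ _ 'rV[R]_n (torus R n)).

Definition step_law (x : X) : {measure set X -> \bar R} :=
  measure_add
    (mscale (NngNum beta0) (pushforward_law (hr x) (measurable_pair2 x.2)))
    (mscale (NngNum beta1) (pushforward_law torus_law (measurable_pair1 x.1))).

Lemma step_lawE x : tsmcmc_step P beta x = step_law x :> (set X -> \bar R).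
Proof. apply/funext => A; apply: esym; exact: measure_addE. Qed.

Lemma measurable_hit_and_run_section (f : X -> \bar R) :
  measurable_fun setT f -> (forall x, 0 <= f x) ->
  measurable_fun setT (fun x : X => \int[hit_and_run P x.1]_q f (q, x.2)).
Proof.
move=> mf f0.
pose g (z : X * 'rV[R]_n) := f (z.2, z.1.2).
have mg : measurable_fun setT g.
  apply: (measurableT_comp mf); apply/measurable_fun_pairP; split => /=.
    exact: measurable_snd.
  exact: (measurableT_comp measurable_snd measurable_fst).
exact: (measurable_fun_integral_sfinite_kernel g hr (fun z => f0 _) mg).
Qed.

Lemma measurable_torus_section (f : X -> \bar R) :
  measurable_fun setT f -> (forall x, 0 <= f x) ->
  measurable_fun setT (fun x : X => \int[torus_law]_theta f (x.1, theta)).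
Proof.
move=> mf f0.
have m1 : measurable_fun setT (fun p => \int[torus_law]_theta f (p, theta)).
  exact: (@measurable_fun_fubini_tonelli_F _ _ _ _ R torus_law f mf f0).
exact: (measurableT_comp m1 measurable_fst).
Qed.

Lemma integral_step_law x (f : X -> \bar R) :
  measurable_fun setT f -> (forall x, 0 <= f x) ->
  \int[step_law x]_y f y =
    beta%:E * \int[hit_and_run P x.1]_q f (q, x.2) +
    (1 - beta)%:E * \int[torus_law]_theta f (x.1, theta).
Proof.
move=> mf f0; rewrite ge0_integral_measure_add//.
rewrite !ge0_integral_mscale//; congr (_ * _ + _ * _).
  have := @ge0_integral_pushforward _ _ _ _ _ _ (measurable_pair2 x.2) (hr x)
    setT f measurableT mf (fun y _ => f0 y).
  by rewrite preimage_setT.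
have := @ge0_integral_pushforward _ _ _ _ _ _ (measurable_pair1 x.1) torus_law
  setT f measurableT mf (fun y _ => f0 y).
by rewrite preimage_setT.
Qed.

Let measurable_step_law U : measurable U ->
  measurable_fun setT (step_law ^~ U).
Proof.
move=> mU; have mI : measurable_fun setT (fun x => (\1_U x)%:E : \bar R).
  by apply/measurable_EFinP; exact: measurable_indic.
have I0 x : 0 <= (\1_U x)%:E :> \bar R by rewrite lee_fin.
rewrite (_ : (step_law ^~ U) = (fun x => \int[step_law x]_y (\1_U y)%:E)).
  under eq_fun do rewrite integral_step_law//.
  apply: emeasurable_funD; apply: measurable_funeM.
    exact: (measurable_hit_and_run_section mI I0).
  exact: (measurable_torus_section mI I0).
by apply/funext => x; rewrite integral_indic// setIT.
Qed.

HB.instance Definition _ := isKernel.Build _ _ _ _ _ step_law measurable_step_law.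

Lemma tsmcmcE m x A : tsmcmc P beta m x A = kernel_iter step_law m x A.
Proof.
elim: m x A => [//|m IHm] x A /=.
rewrite (_ : (fun y => tsmcmc P beta m y A) = (fun y => kernel_iter step_law m y A)).
  by rewrite step_lawE.
by apply/funext => y; exact: IHm.
Qed.

End step_kernel.

(** * Geometric ergodicity of the toric chain *)

Section chain.
Context {R : realType} {n : nat} (P : set 'rV[R]_n) (M beta : R).
Local Notation mu := (lebesgue_rV n : set 'rV[R]_n -> \bar R).
Hypothesis n0 : (0 < n)%N.
Hypothesis mP : measurable P.
Hypothesis cP : convex_set P.
Hypothesis M0 : 0 < M.
Hypothesis PM : forall p q, P p -> P q -> norm2 (q - p) <= M.
Hypothesis P01 : (0 < mu P < +oo)%E.
Hypothesis Pint : P° !=set0.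
Hypothesis boundary0 : mu (P `\` P°) = 0%E.
Hypothesis torus1 : torus_law [set: torus R n] = 1%E.
Hypothesis beta01 : 0 < beta < 1.
Local Notation X := ('rV[R]_n * torus R n)%type.
Local Open Scope ereal_scope.

Let B01 : 0 < mu unit_ball < +oo.
Proof. exact: (unit_ball_measure_bounds mP M0 PM P01 Pint). Qed.

Let lambda := uniform_law mu mP.
Let tau : set (torus R n) -> \bar R := torus_law.
HB.instance Definition _ := SubProbability.on lambda.
HB.instance Definition _ := SubProbability.on tau.

Let stationary := lambda \x tau.
HB.instance Definition _ := Measure.on stationary.

Let lambda1 : lambda setT = 1. Proof. exact: uniform_law_setT. Qed.

Let stationary1 : stationary setT = 1.
Proof.
rewrite -setXTT; apply: (etrans
  (@product_measure1E _ _ _ _ R lambda tau _ _ measurableT measurableT)).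
by rewrite [X in X * _]lambda1 [X in _ * X]torus1 mule1.
Qed.

HB.instance Definition _ :=
  Measure_isProbability.Build _ _ _ stationary stationary1.

Let integral_stationary (f : X -> \bar R) :
  measurable_fun setT f -> (forall x, 0 <= f x) ->
  \int[stationary]_x f x = \int[lambda]_p \int[tau]_theta f (p, theta).
Proof. by move=> mf f0; exact: (@fubini_tonelli1 _ _ _ _ R lambda tau f mf f0). Qed.

Let mtau (f : X -> \bar R) : measurable_fun setT f -> (forall x, 0 <= f x) ->
  measurable_fun setT (fun p => \int[tau]_theta f (p, theta)).
Proof.
by move=> mf f0; exact: (@measurable_fun_fubini_tonelli_F _ _ _ _ R tau f mf f0).
Qed.

Let Q := step_law mP beta01.

Let beta0 : (0 <= beta)%R. Proof. by case/andP: beta01 => /ltW. Qed.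
Let beta1 : (0 <= 1 - beta)%R.
Proof. by rewrite subr_ge0; case/andP: beta01 => _ /ltW. Qed.

Let move_point (f : X -> \bar R) (x : X) : \bar R :=
  \int[hit_and_run P x.1]_q f (q, x.2).

Let move_angle (f : X -> \bar R) (x : X) : \bar R :=
  \int[tau]_theta f (x.1, theta).

Let move_point_ge0 f x : (forall x, 0 <= f x) -> 0 <= move_point f x.
Proof.
move=> f0; rewrite /move_point -(@hit_and_run_kernelE _ _ _ mP _ _ _
  (@measurable_id _ _ [set: 'rV[R]_n]) x.1).
exact: integral_ge0.
Qed.

Let move_angle_ge0 f x : (forall x, 0 <= f x) -> 0 <= move_angle f x.
Proof. by move=> f0; exact: integral_ge0. Qed.

Let mmove_point f : measurable_fun setT f -> (forall x, 0 <= f x) ->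
  measurable_fun setT (move_point f).
Proof. exact: measurable_hit_and_run_section. Qed.

Let mmove_angle f : measurable_fun setT f -> (forall x, 0 <= f x) ->
  measurable_fun setT (move_angle f).
Proof. exact: measurable_torus_section. Qed.

Let integral_step f x : measurable_fun setT f -> (forall x, 0 <= f x) ->
  \int[Q x]_y f y = beta%:E * move_point f x + (1 - beta)%:E * move_angle f x.
Proof. exact: integral_step_law. Qed.

Let integral_lambda h : measurable_fun setT h -> (forall p, 0 <= h p) ->
  \int[lambda]_p h p = ((fine (mu P))^-1)%:E * \int[mu]_(p in P) h p.
Proof. by move=> mh h0; exact: (ge0_integral_uniform_on _ mP). Qed.

Lemma move_point_invariant (f : X -> \bar R) :
  measurable_fun setT f -> (forall x, 0 <= f x) ->
  \int[stationary]_x move_point f x = \int[stationary]_x f x.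
Proof.
move=> mf f0; have mpf := mmove_point mf f0.
have pf0 x : 0 <= move_point f x by exact: move_point_ge0.
rewrite !integral_stationary//.
transitivity (\int[tau]_theta \int[lambda]_p move_point f (p, theta)).
  exact: (@fubini_tonelli _ _ _ _ R lambda tau).
transitivity (\int[tau]_theta \int[lambda]_p f (p, theta)); last first.
  by apply: esym; exact: (@fubini_tonelli _ _ _ _ R lambda tau).
apply: eq_integral => theta _.
have mft := measurableT_comp mf (measurable_pair2 theta).
have mpt := measurableT_comp mpf (measurable_pair2 theta).
transitivity ((fine (mu P))^-1%:E * \int[mu]_(p in P) move_point f (p, theta)).
  exact: (integral_lambda mpt (fun _ => pf0 _)).
transitivity ((fine (mu P))^-1%:E * \int[mu]_(p in P) f (p, theta)); last first.
  by apply: esym; exact: (integral_lambda mft (fun _ => f0 _)).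
congr (_ * _).
exact: (hit_and_run_invariant n0 mP M0 PM P01 Pint boundary0 mft (fun _ => f0 _)).
Qed.

Lemma move_angle_invariant (f : X -> \bar R) :
  measurable_fun setT f -> (forall x, 0 <= f x) ->
  \int[stationary]_x move_angle f x = \int[stationary]_x f x.
Proof.
move=> mf f0; have maf := mmove_angle mf f0.
rewrite !integral_stationary//; last by move=> x; exact: move_angle_ge0.
apply: eq_integral => p _; rewrite /move_angle/=.
by rewrite integral_cst// [X in _ * X]torus1 mule1.
Qed.

Lemma step_invariant (f : X -> \bar R) :
  measurable_fun setT f -> (forall x, 0 <= f x) ->
  \int[stationary]_x \int[Q x]_y f y = \int[stationary]_x f x.
Proof.
move=> mf f0; under eq_integral do rewrite integral_step//.
have mpf := mmove_point mf f0; have maf := mmove_angle mf f0.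
have pf0 x : 0 <= move_point f x by exact: move_point_ge0.
have af0 x : 0 <= move_angle f x by exact: move_angle_ge0.
rewrite ge0_integralD//; [|by move=> x _; rewrite mule_ge0|exact: measurable_funeM|
  by move=> x _; rewrite mule_ge0|exact: measurable_funeM].
rewrite !ge0_integralZl//.
rewrite move_point_invariant// move_angle_invariant// -ge0_muleDl ?lee_fin//.
by rewrite -EFinD addrC subrK mul1e.
Qed.

Let step_constant : R := beta * (1 - beta) *
  ((2 * M)^-1 * @polar_constant R n M * fine (mu P)).

(** Only the paths that move the point first and the angle next are kept. *)
Lemma step_minorization (f : X -> \bar R) x :
  measurable_fun setT f -> (forall x, 0 <= f x) -> P° x.1 ->
  step_constant%:E * \int[stationary]_y f y <= \int[Q x]_y \int[Q y]_z f z.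
Proof.
move=> mf f0 Px.
have muP0 : fine (mu P) != 0%R.
  by have [P0 Poo] := andP P01; rewrite gt_eqF// fine_gt0// P0.
pose h q := \int[tau]_theta f (q, theta).
have mh : measurable_fun setT h by exact: mtau.
have h0 q : 0 <= h q by exact: integral_ge0.
have mQf : measurable_fun setT (fun y => \int[Q y]_z f z).
  exact: (measurable_fun_integral_kernel (measurable_kernel Q)).
have Qf0 y : 0 <= \int[Q y]_z f z by exact: integral_ge0.
rewrite [leRHS]integral_step//.
apply: (@le_trans _ _ (beta%:E * move_point (fun y => \int[Q y]_z f z) x)); last first.
  by rewrite leeDl// mule_ge0// move_angle_ge0.
rewrite integral_stationary// integral_lambda// /step_constant.
rewrite (_ : _ * _ = beta%:E * ((1 - beta)%:E *
    (((2 * M)^-1 * @polar_constant R n M)%:E * \int[mu]_(p in P) h p)));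
  last first.
  rewrite !muleA -!EFinM; congr (_%:E * _).
  by field; rewrite muP0/= gt_eqF.
apply: lee_wpmul2l => //.
apply: (@le_trans _ _ ((1 - beta)%:E * \int[hit_and_run P x.1]_q h q)).
  apply: lee_wpmul2l => //.
  exact: (hit_and_run_minorization n0 mP M0 PM P01 Pint Px mh h0).
rewrite /move_point -(@hit_and_run_kernelE _ _ _ mP _ _ _
  (@measurable_id _ _ [set: 'rV[R]_n]) x.1).
rewrite -ge0_integralZl//; apply: ge0_le_integral => //.
- by move=> q _; rewrite mule_ge0.
- exact: measurable_funeM.
- exact: (measurableT_comp mQf (measurable_pair2 x.2)).
move=> q _; rewrite integral_step// leeDr// mule_ge0//; exact: move_point_ge0.
Qed.

Lemma step_setT x : P° x.1 -> Q x setT = 1.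
Proof.
move=> Px; rewrite /Q -step_lawE /tsmcmc_step.
rewrite [X in _ * X + _](_ : _ = 1);
  last exact: (hit_and_run_setT n0 mP M0 PM P01 Pint Px).
rewrite [X in _ + _ * X](_ : _ = 1); last exact: torus1.
by rewrite !mule1 -EFinD addrC subrK.
Qed.

Lemma step_stays_inside x : P° x.1 -> Q x (~` aa_dom P) = 0.
Proof.
move=> Px; rewrite /Q -step_lawE /tsmcmc_step.
rewrite [X in _ * X + _](_ : _ = 0); last first.
  rewrite -(hit_and_run_stays_inside n0 mP cP M0 PM P01 Pint Px); congr hit_and_run.
  apply/seteqP; split => q /=; apply: contra_not; last by case.
  by move=> Pq; split.
rewrite [X in _ + _ * X](_ : _ = 0); last first.
  rewrite (_ : [set theta | _] = set0); first exact: (measure0 tau).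
  by apply/seteqP; split => theta //=; apply; split.
by rewrite !mule0 adde0.
Qed.

(** [doeblin_geometric] for the kernel [Q] on the set [aa_dom P]. *)
Theorem tsmcmc_geometric : exists2 r : R, (0 < r < 1)%R &
  forall x m A, P° x.1 -> measurable A ->
    `|tsmcmc P beta m x A - (uniform_on mu P \x torus_uniform) A| <= (r ^+ m./2)%:E.
Proof.
(* the minimum keeps the ratio [1 - eps] positive *)
pose eps := (Num.min step_constant 2^-1)%R.
have muP0 : (0 < fine (mu P))%R.
  by have [P0 Poo] := andP P01; rewrite fine_gt0// P0.
have step_constant_gt0 : (0 < step_constant)%R.
  have [b0 b1] := andP beta01.
  apply: mulr_gt0; first by rewrite mulr_gt0// subr_gt0.
  apply: mulr_gt0 => //; apply: mulr_gt0; first by rewrite invr_gt0 mulr_gt0.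
  exact: polar_constant_gt0.
have eps01 : (0 < eps < 1)%R.
  rewrite lt_min step_constant_gt0/= invr_gt0 ltr0n/= gt_min.
  by rewrite [X in _ || X]invf_lt1 ?ltr1n ?orbT.
exists (1 - eps)%R; first by rewrite subr_gt0 ltrBlDr ltrDl andbC.
move=> x m A Px mA.
have mD : measurable (aa_dom P : set X).
  apply: measurableX => //; apply: open_measurable_rV; exact: open_interior.
rewrite (tsmcmcE mP beta01).
apply: (@doeblin_geometric _ _ _ Q (aa_dom P) stationary eps mD) => //.
- by move=> y [Py _]; exact: step_setT.
- by move=> y [Py _]; exact: step_stays_inside.
- exact: step_invariant.
- move=> f y mf f0 [Py _]; apply: le_trans (step_minorization mf f0 Py).
  apply: lee_wpmul2r; first exact: integral_ge0.
  by rewrite lee_fin ge_min lexx.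
Qed.

End chain.

(** * Mass of the polytope, and the convergence theorem *)

Section polytope_mass.
Context {R : realType} {n : nat} (P : set 'rV[R]_n).
Local Notation mu := (lebesgue_rV n : set 'rV[R]_n -> \bar R).
Hypothesis mP : measurable P.
Local Open Scope ereal_scope.

(** Both factors are at most one, also in the degenerate cases of [uniform_on]. *)
Lemma uniform_torus_mass1 :
  (uniform_on mu P \x torus_uniform) (aa_dom P) = 1 ->
  uniform_on mu P P° = 1 /\ torus_law [set: torus R n] = 1.
Proof.
have mPo : measurable P° by apply: open_measurable_rV; exact: open_interior.
have -> : (uniform_on mu P \x torus_uniform) (aa_dom P) =
    uniform_on mu P P° * torus_law [set: torus R n].
  exact: (@product_measure1E _ _ _ _ R
    (uniform_law mu mP) torus_law _ _ mPo measurableT).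
have := uniform_on_le1 mu mP mPo; have := uniform_on_ge0 mu P P°.
have : torus_law [set: torus R n] <= 1 by exact: sprobability_setT.
have : 0 <= torus_law [set: torus R n] by exact: measure_ge0.
case: (uniform_on mu P P°) => [a| |]//; case: (torus_law _) => [b| |]//.
rewrite !lee_fin => b0 b1 a0 a1; rewrite -EFinM => -[ab].
by split; congr EFin; apply/eqP; rewrite eq_le ?a1 ?b1/= -ab;
  [rewrite ler_piMr|rewrite ler_piMl].
Qed.

(** A uniform law that is not zero comes from a set of finite positive measure. *)
Lemma uniform_interior_bounds :
  uniform_on mu P P° = 1 -> 0 < mu P < +oo /\ mu (P `\` P°) = 0.
Proof.
have mPo : measurable P° by apply: open_measurable_rV; exact: open_interior.
rewrite uniform_onE// (setIidl (@interior_subset _ P)) => E.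
have muP0 : fine (mu P) != 0%R.
  apply/eqP => z; move: E; rewrite z invr0 mul0e => -[] /eqP.
  by rewrite eq_sym oner_eq0.
have P01 : 0 < mu P < +oo.
  have : 0 <= mu P by []. 
  move: muP0; case: (mu P) => [r| |]//=; last by rewrite eqxx.
  by rewrite lee_fin lte_fin ltry andbT lt_neqAle eq_sym => -> ->.
split => //.
have muPfin : mu P \is a fin_num by rewrite ge0_fin_numE//; case/andP: P01.
have muPo : mu P° = mu P.
  rewrite -[RHS]mule1 -E muleA -{1}(fineK muPfin) -EFinM mulfV// mul1e//.
transitivity (mu P - mu P°); last by rewrite muPo subee.
rewrite -[in RHS](setIidr (@interior_subset _ P)).
by apply: measureD => //; case/andP: P01.
Qed.

End polytope_mass.

Theorem theorem26 (R : realType) (n : nat) (hn : (0 < n)%N)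
    (M : toric_manifold R n) (nu : probability (borel M) R)
    (hnu : symplectic_measure nu)
    (P : set 'rV[R]_n) (hP : moment_polytope M P)
    (alpha : 'rV[R]_n * torus R n -> borel M) (halpha : action_angle nu P alpha)
    (beta : R) (hbeta : 0 < beta < 1) :
  exists C rho : R, rho < 1 /\
    forall (p : 'rV[R]_n) (theta : torus R n), P° p ->
    forall m : nat, (1 <= m)%N ->
      (tv_dist (aa_pushforward P alpha (tsmcmc P beta m (p, theta))) nu
        < (C * rho ^+ m)%:E)%E.
Proof.
have cptP := moment_polytope_compact hP.
have mP := compact_measurable_rV cptP.
have [_ /convex_polytope_convex cP Pint] := hP.
have [D D0 PD] := compact_norm2_bounded cptP.
have [[falpha _ _] _ _ malpha nuE] := halpha.
have mD : measurable (aa_dom P : set ('rV[R]_n * torus R n)).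
  apply: measurableX => //; apply: open_measurable_rV; exact: open_interior.
have [Po1 tau1] : uniform_on (lebesgue_rV n) P P° = 1%E /\
    torus_law [set: torus R n] = 1%E.
  apply: uniform_torus_mass1 => //.
  rewrite -(@probability_setT _ _ _ nu) -(nuE setT measurableT).
  by rewrite /aa_pushforward preimage_setT setIT.
have [P01 boundary0] := uniform_interior_bounds mP Po1.
have [r /andP[r0 r1] rP] :=
  tsmcmc_geometric hn mP cP D0 PD P01 Pint boundary0 tau1 hbeta.
(* the bound decreases every other step, whence the square root *)
pose rho := Num.sqrt r.
have rho0 : 0 < rho by rewrite sqrtr_gt0.
have rho1 : rho < 1 by rewrite -sqrtr1 ltr_sqrt.
have rhorho : rho ^+ 2 = r by rewrite sqr_sqrtr// ltW.
exists (2 / rho), rho; split=> // p theta Pp m m0.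
apply: (@le_lt_trans _ _ (r ^+ m./2)%:E).
  apply: ge_ereal_sup => _ [A mA <-]; rewrite -nuE//.
  apply: rP => //; exact: malpha.
rewrite lte_fin -rhorho -exprM.
apply: (@le_lt_trans _ _ (rho ^+ m.-1)).
  apply: ler_wiXn2l; rewrite ?ltW//.
  rewrite mul2n -subn1 leq_subLR -{1}(odd_double_half m) leq_add2r.
  by case: odd.
rewrite -{2}(prednK m0) exprS mulrA divfK ?gt_eqF//.
by rewrite ltr_pMl ?ltr1n// exprn_gt0.
Qed.
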